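(* Let $a,p>0$, $R>0$, let $K\subset\mathbb{R}^d$ be compact, let $\Omega\subset\mathbb{R}^d$ be a bounded domain, let $Y$ be a Banach space, and let $F:\mathcal{D}(F)\to Y$ be a (possibly nonlinear) mapping. Assume the link condition: there are constants $0<m\le M<\infty$ such that for all $u_1,u_2\in\mathcal{D}(F)\cap B^{-a}(\mathbb{R}^d)$ $$m\,\|u_1-u_2\|_{B^{-a}(\mathbb{R}^d)}\le\|F(u_1)-F(u_2)\|_{Y}\le M\,\|u_1-u_2\|_{B^{-a}(\mathbb{R}^d)} .$$ Fix $u^\ast\in B^p(\mathbb{R}^d)$ and let $$\mathcal{M}(R)=\{z\in\mathcal{D}(F)\cap B^p(\mathbb{R}^d)\cap\mathcal{E}'(K): \|z-u^\ast\|_{B^p(\mathbb{R}^d)}\le R\}.$$ Then there exists a constant $C<\infty$ such that $$\|u_1-u_2\|_{L^2(\Omega)}\le C\,\|F(u_1)-F(u_2)\|_Y^{\frac{p}{p+a}}\,R^{\frac{a}{p+a}}\qquad\text{for all }u_1,u_2\in\mathcal{M}(R).$$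
   Context: For $s\in\mathbb{R}$, the spectral Barron space $B^s(\mathbb{R}^d)$ consists of the tempered distributions $u$ whose Fourier transform $\hat u$ is a function with $\|u\|_{B^s(\mathbb{R}^d)}:=\int_{\mathbb{R}^d}|\hat u(\xi)|\,(1+|\xi|^2)^{s/2}\,d\xi<\infty$. $\mathcal{E}'(K)$ denotes the set of distributions supported in the compact set $K$. $\mathcal{D}(F)$ is the domain of $F$, consisting of elements of spectral Barron spaces. *)

(* Defs.v *)
From HB Require Import structures.
From mathcomp Require Import all_boot all_order all_algebra.
From mathcomp Require Import all_classical all_reals all_analysis.
From mathcomp.real_closed Require Import complex.

Set Implicit Arguments.
Unset Strict Implicit.
Unset Printing Implicit Defensive.
Import Order.TTheory GRing.Theory Num.Theory.
Import numFieldNormedType.Exports.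
Local Open Scope classical_set_scope.
Local Open Scope complex_scope.
Local Open Scope ring_scope.

Section measurable_rV.
Context (R : realType) (d : nat).

Let coords (i : 'I_d) (x : 'rV[R]_d) : measurableTypeR R := x ord0 i.

Let rV_set0 : g_sigma_preimage coords set0.
Proof. exact: sigma_algebra0. Qed.

Let rV_setC A : g_sigma_preimage coords A -> g_sigma_preimage coords (~` A).
Proof. exact: sigma_algebraC. Qed.

Let rV_bigcup (F : _^nat) : (forall i, g_sigma_preimage coords (F i)) ->
  g_sigma_preimage coords (\bigcup_i (F i)).
Proof. exact: sigma_algebra_bigcup. Qed.

(* The Borel sets of R^d, as the product of the Borel sigma-algebras of R. *)
HB.instance Definition _ := @isMeasurable.Build default_measure_display
  'rV[R]_d (g_sigma_preimage coords) rV_set0 rV_setC rV_bigcup.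

End measurable_rV.

Section lebesgue_rV.
Context {R : realType}.

Lemma measurable_coord d (i : 'I_d) :
  measurable_fun [set: 'rV[R]_d] (fun x => x ord0 i).
Proof.
move=> _ Y mY; rewrite setTI; apply: sub_sigma_algebra => /=.
rewrite -bigcup_seq/=; exists i => /=; first by rewrite mem_index_enum.
by exists Y => //; rewrite setTI.
Qed.

Lemma measurable_fun_rVP d d1 (T1 : measurableType d1) (f : T1 -> 'rV[R]_d) :
  (forall i, measurable_fun [set: T1] (fun x => f x ord0 i)) ->
  measurable_fun [set: T1] f.
Proof.
move=> mf _ A mA; rewrite setTI.
have : preimage_set_system setT f
    (g_sigma_preimage (fun i (x : 'rV[R]_d) => x ord0 i : measurableTypeR R))
    (f @^-1` A) by exists A => //; rewrite setTI.
rewrite -(g_sigma_preimage_comp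
  (fun i (x : 'rV[R]_d) => x ord0 i : measurableTypeR R) f).
suff : g_sigma_preimage
    (fun i t => f t ord0 i : measurableTypeR R) `<=` measurable by exact.
apply: smallest_sub; first exact: sigma_algebra_measurable.
apply: (big_ind (fun S : set (set T1) => S `<=` measurable)) => //.
  by move=> ? ? ? ?; rewrite subUset.
by move=> i _ B [C mC <-]; exact: mf.
Qed.

Definition rV_cons d (p : R * 'rV[R]_d) : 'rV[R]_d.+1 :=
  row_mx (const_mx p.1 : 'rV_1) p.2.

Definition rV_uncons d (x : 'rV[R]_d.+1) : R * 'rV[R]_d :=
  (x ord0 ord0, \row_i x ord0 (lift ord0 i)).

Lemma rV_consK d : cancel (@rV_cons d) (@rV_uncons d).
Proof.
move=> [a x]; congr pair => /=.
  by rewrite mxE; case: splitP => j //; rewrite mxE.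
apply/rowP => i; rewrite !mxE; case: splitP => [j|j /= ij].
  by case: j => -[|//] /= ? /eqP; rewrite /bump.
by congr (x _ _); apply/val_inj; case: ij.
Qed.

Lemma rV_unconsK d : cancel (@rV_uncons d) (@rV_cons d).
Proof.
move=> x; apply/rowP => i; rewrite mxE; case: splitP => j ij; rewrite !mxE /=.
  by congr (x _ _); apply/val_inj; rewrite /= ij; case: j {ij} => -[].
by congr (x _ _); apply/val_inj; rewrite /= ij.
Qed.

Lemma measurable_rV_cons d : measurable_fun [set: R * 'rV[R]_d] (@rV_cons d).
Proof.
apply: measurable_fun_rVP => i.
case e : (fintype.split (i : 'I_(1 + d))) => [j|j].
  apply: (eq_measurable_fun fst) => [p _|]; last exact: measurable_fst.
  by rewrite mxE e mxE.
apply: (eq_measurable_fun (fun p : R * 'rV[R]_d => p.2 ord0 j)) => [p _|].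
  by rewrite mxE e.
apply: (measurableT_comp (@measurable_coord d j)); exact: measurable_snd.
Qed.

Lemma measurable_rV_uncons d : measurable_fun [set: 'rV[R]_d.+1] (@rV_uncons d).
Proof.
apply: measurable_fun_pair; first exact: measurable_coord.
apply: measurable_fun_rVP => i.
apply: (eq_measurable_fun (fun x : 'rV[R]_d.+1 => x ord0 (lift ord0 i))) => [x _|].
  by rewrite /= mxE.
exact: measurable_coord.
Qed.

Section lebesgue_cons.
Context d (m : {sigma_finite_measure set 'rV[R]_d -> \bar R}).

Definition lebesgue_cons : set 'rV[R]_d.+1 -> \bar R :=
  pushforward (@lebesgue_measure R \x m)%E (@rV_cons d).

Let lebesgue_cons0 : lebesgue_cons set0 = 0%E.
Proof. by rewrite /lebesgue_cons /pushforward preimage_set0 measure0. Qed.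

Let lebesgue_cons_ge0 A : (0 <= lebesgue_cons A)%E.
Proof. by apply: measure_ge0; exact: measurable_rV_cons. Qed.

Let lebesgue_cons_sigma_additive : semi_sigma_additive lebesgue_cons.
Proof.
by apply: measure_semi_sigma_additive; exact: measurable_rV_cons.
Qed.

HB.instance Definition _ := isMeasure.Build _ _ _ lebesgue_cons
  lebesgue_cons0 lebesgue_cons_ge0 lebesgue_cons_sigma_additive.

Let lebesgue_cons_sigma_finite : sigma_finite setT lebesgue_cons.
Proof.
have [F TF mF] : sigma_finite setT (@lebesgue_measure R \x m)%E.
  have /sigma_finiteP[F [TF ndF Foo]] := sigma_finiteT (@lebesgue_measure R).
  have /sigma_finiteP[G [TG ndG Goo]] := sigma_finiteT m.
  exists (fun n => F n `*` G n).
    rewrite -setXTT TF TG predeqE => -[x y]; split.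
      move=> [/= [n _ Fnx] [k _ Gky]]; exists (maxn n k) => //; split.
      - by move: x Fnx; exact/subsetPset/ndF/leq_maxl.
      - by move: y Gky; exact/subsetPset/ndG/leq_maxr.
    by move=> [n _ []/= ? ?]; split; exists n.
  move=> k; have [? ?] := Foo k; have [? ?] := Goo k.
  split; first exact: measurableX.
  by rewrite product_measure1E// lte_mul_pinfty// ge0_fin_numE.
exists (fun i => @rV_uncons d @^-1` F i).
  by rewrite -preimage_bigcup -TF preimage_setT.
move=> i; have [mFi Fioo] := mF i; split.
  by rewrite -[X in measurable X]setTI; exact: measurable_rV_uncons.
rewrite /lebesgue_cons /pushforward -comp_preimage.
by rewrite (_ : _ \o _ = id) //; apply/funext => p /=; rewrite rV_consK.
Qed.

HB.instance Definition _ := Measure_isSigmaFinite.Build _ _ _ lebesgue_cons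
  lebesgue_cons_sigma_finite.

End lebesgue_cons.

Fixpoint lebesgue_rV d : {sigma_finite_measure set 'rV[R]_d -> \bar R} :=
  if d is d'.+1 then lebesgue_cons (lebesgue_rV d') else \d_(0 : 'rV[R]_0).

Lemma lebesgue_rV_box d (A : 'I_d -> set R) : (forall i, measurable (A i)) ->
  lebesgue_rV d [set x | forall i, A i (x ord0 i)] =
  (\prod_(i < d) @lebesgue_measure R (A i))%E.
Proof.
elim: d A => [|d IH] A mA /=.
  by rewrite big_ord0 diracE mem_set // => -[].
have mB : measurable [set x : 'rV[R]_d | forall i, A (lift ord0 i) (x ord0 i)].
  rewrite (_ : [set _ | _] = \bigcap_(i : 'I_d)
      ((fun x : 'rV[R]_d => x ord0 i) @^-1` A (lift ord0 i))); last first.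
    by apply/seteqP; split=> x /= H i; [move=> _|]; exact: H.
  apply: fin_bigcap_measurable => // i _.
  by rewrite -[X in measurable X]setTI; exact: measurable_coord.
rewrite big_ord_recl -IH // -product_measure1E // /lebesgue_cons /pushforward.
congr (_ _); apply/seteqP; split=> -[a x] /=.
  move=> H; split => [|i]; have := rV_consK (a, x) => -[ea ex].
    by rewrite /= -ea; exact: H.
  by have := H (lift ord0 i); rewrite -{2}ex mxE.
move=> [Aa Ax] i; have [ea ex] := rV_consK (a, x).
case: (unliftP ord0 i) => [j ->|->]; last by rewrite ea.
by have := Ax j; rewrite -{1}ex mxE.
exact: mA.
Qed.

End lebesgue_rV.

Local Notation normc := ComplexField.Normc.normc.

Section linear_combination.
Context {R : realType} {V : normedModType R}.
Variables (b c : R) (F G H : V -> R).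

Lemma derivable_comb (x e : V) :
  derivable F x e -> derivable G x e -> derivable H x e ->
  derivable (b *: F + c *: G + H) x e.
Proof.
move=> dF dG dH.
exact: (derivableD (derivableD (derivableZ (k := b) dF)
  (derivableZ (k := c) dG)) dH).
Qed.

Lemma derive_comb (x e : V) :
  derivable F x e -> derivable G x e -> derivable H x e ->
  'D_e (b *: F + c *: G + H) x = b * 'D_e F x + c * 'D_e G x + 'D_e H x.
Proof.
move=> dF dG dH; have dbF := derivableZ (k := b) dF.
have dcG := derivableZ (k := c) dG.
apply: etrans (deriveD (derivableD dbF dcG) dH) _.
congr (_ + _); apply: etrans (deriveD dbF dcG) _.
by congr (_ + _); exact: deriveZ.
Qed.

Lemma continuous_comb : continuous F -> continuous G -> continuous H ->
  continuous (b *: F + c *: G + H).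
Proof.
move=> cF cG cH x.
exact: (continuousD (continuousD (continuousZl_tmp (k := b) (cF x))
  (continuousZl_tmp (k := c) (cG x))) (cH x)).
Qed.

End linear_combination.

Section schwartz.
Context {R : realType} {d : nat}.
Local Notation V := 'rV[R]_d.
Local Notation C := R[i].
Implicit Types (f g : V -> C) (s : seq 'I_d).

Definition reF (f : V -> C) (x : V) : R := complex.Re (f x).
Definition imF (f : V -> C) (x : V) : R := complex.Im (f x).

Definition dotv (x y : V) : R := \sum_(i < d) x ord0 i * y ord0 i.

Definition partial (i : 'I_d) (f : V -> C) : V -> C :=
  fun x => ('D_(delta_mx ord0 i) (reF f) x +i* 'D_(delta_mx ord0 i) (imF f) x)%C.

(* A multi-index is represented by the list of directions of the successive
   derivatives. *)
Definition partials (s : seq 'I_d) (f : V -> C) : V -> C := foldr partial f s.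

Definition smooth (f : V -> C) : Prop :=
  forall s, [/\ continuous (reF (partials s f)),
                continuous (imF (partials s f)) &
                forall i x,
                  derivable (reF (partials s f)) x (delta_mx ord0 i) /\
                  derivable (imF (partials s f)) x (delta_mx ord0 i)].

Definition schwartz_seminorm (N : nat) (f : V -> C) : \bar R :=
  ereal_sup [set ((1 + dotv x x) ^+ N * normc (partials s f x))%:E
            | x in [set: V] & s in [set s : seq 'I_d | (size s <= N)%N]].

Definition is_schwartz (f : V -> C) : Prop :=
  smooth f /\ forall N, (schwartz_seminorm N f < +oo)%E.

Definition schwartz_pred : {pred V -> C} := fun f => `[< is_schwartz f >].

Let reFZD (a : C) f g : reF (a *: f + g) =
  (complex.Re a *: reF f - complex.Im a *: imF f) + reF g.
Proof.
apply/funext => x; change (complex.Re (a * f x + g x) =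
  complex.Re a * reF f x - complex.Im a * imF f x + reF g x).
by rewrite /reF /imF; case: a (f x) (g x) => [? ?] [? ?] [? ?].
Qed.

Let imFZD (a : C) f g : imF (a *: f + g) =
  (complex.Re a *: imF f + complex.Im a *: reF f) + imF g.
Proof.
apply/funext => x; change (complex.Im (a * f x + g x) =
  complex.Re a * imF f x + complex.Im a * reF f x + imF g x).
by rewrite /reF /imF; case: a (f x) (g x) => [? ?] [? ?] [? ?].
Qed.

Lemma partialsZD s (a : C) f g : smooth f -> smooth g ->
  partials s (a *: f + g) = a *: partials s f + partials s g.
Proof.
move=> sf sg; elim: s => [//|i s IH] /=; rewrite IH; apply/funext => x.
have [_ _ /(_ i x) [df1 df2]] := sf s; have [_ _ /(_ i x) [dg1 dg2]] := sg s.
rewrite /partial reFZD imFZD -scaleNr !derive_comb //.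
change (Complex
  (complex.Re a * 'D_(delta_mx ord0 i) (reF (partials s f)) x +
   - complex.Im a * 'D_(delta_mx ord0 i) (imF (partials s f)) x +
   'D_(delta_mx ord0 i) (reF (partials s g)) x)
  (complex.Re a * 'D_(delta_mx ord0 i) (imF (partials s f)) x +
   complex.Im a * 'D_(delta_mx ord0 i) (reF (partials s f)) x +
   'D_(delta_mx ord0 i) (imF (partials s g)) x) =
  a * partial i (partials s f) x + partial i (partials s g) x).
by case: a {IH} => a1 a2; rewrite /partial mulNr; simpc.
Qed.

Lemma smoothZD (a : C) f g : smooth f -> smooth g -> smooth (a *: f + g).
Proof.
move=> sf sg s; rewrite partialsZD // reFZD imFZD -scaleNr.
have [cf1 cf2 df] := sf s; have [cg1 cg2 dg] := sg s.
split; [exact: continuous_comb|exact: continuous_comb|move=> i x].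
by have [? ?] := df i x; have [? ?] := dg i x; split; apply: derivable_comb.
Qed.

Lemma schwartz_seminormZD (a : C) f g N : smooth f -> smooth g ->
  (schwartz_seminorm N (a *: f + g)%R <=
   (normc a)%:E * schwartz_seminorm N f + schwartz_seminorm N g)%E.
Proof.
move=> sf sg; apply: ub_ereal_sup => _ [x _ [s sN] <-]; rewrite partialsZD //.
have w0 : 0 <= (1 + dotv x x) ^+ N.
  apply: exprn_ge0; apply: addr_ge0 => //; apply: sumr_ge0 => i _.
  by rewrite -expr2 sqr_ge0.
apply: (@le_trans _ _ ((normc a)%:E *
    ((1 + dotv x x) ^+ N * normc (partials s f x))%:E +
    ((1 + dotv x x) ^+ N * normc (partials s g x))%:E)%E).
  rewrite -EFinM -EFinD lee_fin mulrCA -mulrDr ler_wpM2l //.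
  by rewrite -ComplexField.Normc.normcM; exact: le_normcD.
apply: leeD; last by apply: ereal_sup_ubound; exists x => //; exists s.
apply: lee_wpmul2l; first by rewrite lee_fin; case: (a) => ? ?; exact: sqrtr_ge0.
by apply: ereal_sup_ubound; exists x => //; exists s.
Qed.

Lemma schwartz_submod_closed : submod_closed schwartz_pred.
Proof.
split.
  apply/asboolP.
  have p0 s : partials s (0 : V -> C) = 0.
    elim: s => [//|i s IH] /=; rewrite IH; apply/funext => x.
    have re0 : reF (0 : V -> C) = cst 0 by [].
    have im0 : imF (0 : V -> C) = cst 0 by [].
    by rewrite /partial re0 im0 !derive_cst.
  split=> [s|N]; first rewrite p0.
    split; [exact: cst_continuous|exact: cst_continuous|].
    by move=> i x; split; exact: derivable_cst.
  apply: (@le_lt_trans _ _ 0%E) => //; apply: ub_ereal_sup => _ [x _ [s _] <-].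
  by rewrite p0 ComplexField.Normc.normc0 mulr0.
move=> a f g /asboolP[sf bf] /asboolP[sg bg]; apply/asboolP; split.
  exact: smoothZD.
move=> N; apply: le_lt_trans (schwartz_seminormZD a N sf sg) _.
apply: lte_add_pinfty => //; apply: lte_mul_pinfty => //.
by rewrite lee_fin; case: (a) => ? ?; exact: sqrtr_ge0.
Qed.

HB.instance Definition _ :=
  GRing.isSubmodClosed.Build C (V -> C) schwartz_pred schwartz_submod_closed.

End schwartz.

Record schwartz (R : realType) (d : nat) := Schwartz {
  schwartz_fun :> 'rV[R]_d -> R[i];
  _ : schwartz_fun \in @schwartz_pred R d }.

HB.instance Definition _ R d := [isSub for @schwartz_fun R d].
HB.instance Definition _ R d := [Choice of schwartz R d by <:].
HB.instance Definition _ R d :=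
  [SubChoice_isSubLmodule of schwartz R d by <:].

Section tempered.
Context {R : realType} {d : nat}.
Local Notation C := R[i].

Definition is_tempered (u : schwartz R d -> C) : Prop :=
  (forall (a : C) phi psi, u (a *: phi + psi) = a * u phi + u psi) /\
  exists (N : nat) (c : R),
    forall phi, ((normc (u phi))%:E <= c%:E * schwartz_seminorm N phi)%E.

Definition tempered_pred : {pred schwartz R d -> C} :=
  fun u => `[< is_tempered u >].

Lemma schwartz_seminorm_ge0 N (f : 'rV[R]_d -> C) :
  (0 <= schwartz_seminorm N f)%E.
Proof.
apply: (@le_trans _ _ ((1 + dotv 0 0) ^+ N * normc (f (0 : 'rV[R]_d)))%:E).
  rewrite lee_fin mulr_ge0 //; last by case: (f _) => ? ?; exact: sqrtr_ge0.
  apply: exprn_ge0; apply: addr_ge0 => //; apply: sumr_ge0 => i _.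
  by rewrite -expr2 sqr_ge0.
by apply: ereal_sup_ubound; exists 0 => //; exists [::].
Qed.

Lemma le_schwartz_seminorm N1 N2 (f : 'rV[R]_d -> C) : (N1 <= N2)%N ->
  (schwartz_seminorm N1 f <= schwartz_seminorm N2 f)%E.
Proof.
move=> N12; apply: ub_ereal_sup => _ [x _ [s /= sN] <-].
apply: (@le_trans _ _ ((1 + dotv x x) ^+ N2 * normc (partials s f x))%:E).
  rewrite lee_fin ler_wpM2r //; first by case: (partials _ _ _) => ? ?; exact: sqrtr_ge0.
  rewrite ler_weXn2l // lerDl; apply: sumr_ge0 => i _.
  by rewrite -expr2 sqr_ge0.
by apply: ereal_sup_ubound; exists x => //; exists s => //=; exact: leq_trans N12.
Qed.

Lemma tempered_zmod_closed : zmod_closed tempered_pred.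
Proof.
split.
  apply/asboolP; split=> [a phi psi|]; first by rewrite mulr0 addr0.
  exists 0%N, 0 => phi.
  by rewrite ComplexField.Normc.normc0 mul0e.
move=> u v /asboolP[lu [N1 [c1 bu]]] /asboolP[lv [N2 [c2 bv]]].
apply/asboolP; split=> [a phi psi|].
  change (u (a *: phi + psi) - v (a *: phi + psi) =
    a * (u phi - v phi) + (u psi - v psi)).
  by rewrite lu lv mulrBr opprD addrACA.
exists (maxn N1 N2), (`|c1| + `|c2|) => phi.
have bnd (w : schwartz R d -> C) N c : (N <= maxn N1 N2)%N ->
    ((normc (w phi))%:E <= c%:E * schwartz_seminorm N phi)%E ->
    ((normc (w phi))%:E <= `|c|%:E * schwartz_seminorm (maxn N1 N2) phi)%E.
  move=> NN; move/le_trans; apply.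
  apply: (@le_trans _ _ (`|c|%:E * schwartz_seminorm N phi)%E).
    apply: lee_wpmul2r; first exact: schwartz_seminorm_ge0.
    by rewrite lee_fin ler_norm.
  by apply: lee_wpmul2l; [rewrite lee_fin|exact: le_schwartz_seminorm].
apply: (@le_trans _ _ ((normc (u phi))%:E + (normc (v phi))%:E)%E).
  rewrite -EFinD lee_fin -(normcN (v phi)).
  exact: le_normcD.
rewrite EFinD ge0_muleDl ?lee_fin //; apply: leeD.
  by apply: (bnd u N1) => //; exact: leq_maxl.
by apply: (bnd v N2) => //; exact: leq_maxr.
Qed.

HB.instance Definition _ :=
  GRing.isZmodClosed.Build (schwartz R d -> C) tempered_pred
    tempered_zmod_closed.

End tempered.

Record tempered (R : realType) (d : nat) := Tempered {
  tempered_fun :> schwartz R d -> R[i];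
  _ : tempered_fun \in @tempered_pred R d }.

HB.instance Definition _ R d := [isSub for @tempered_fun R d].
HB.instance Definition _ R d := [Choice of tempered R d by <:].
HB.instance Definition _ R d :=
  [SubChoice_isSubZmodule of tempered R d by <:].

Section distributions.
Context {R : realType} {d : nat}.
Local Notation V := 'rV[R]_d.
Local Notation C := R[i].
Local Notation mu := (@lebesgue_rV R d).
Implicit Types (u : tempered R d) (f g : V -> C) (Omega K : set V).

Definition Cmeasurable (D : set V) f : Prop :=
  measurable_fun D (reF f) /\ measurable_fun D (imF f).

Definition Cintegrable (D : set V) f : Prop :=
  mu.-integrable D (EFin \o reF f) /\ mu.-integrable D (EFin \o imF f).

Definition Cintegral (D : set V) f : C :=
  (\int[mu]_(x in D) reF f x +i* \int[mu]_(x in D) imF f x)%C.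

(* Normalization without prefactor; any other choice changes the norms below
   by constant factors only. *)
Definition fourier f (xi : V) : C :=
  Cintegral [set: V]
    (fun x => f x * (cos (dotv x xi) -i* sin (dotv x xi))%C).

(* The distributional Fourier transform of u, i.e. phi |-> u (fourier phi), is
   the regular tempered distribution given by the function g. As the Fourier
   transform of a Schwartz function is Schwartz, every phi has its psi. *)
Definition fourier_transform_is u g : Prop :=
  [/\ Cmeasurable [set: V] g,
      forall phi : schwartz R d, Cintegrable [set: V] (fun xi => g xi * phi xi) &
      forall phi psi : schwartz R d, (forall xi, psi xi = fourier phi xi) ->
        u psi = Cintegral [set: V] (fun xi => g xi * phi xi)].

Definition barron_integral (s : R) g : \bar R :=
  (\int[mu]_xi (normc (g xi) * (1 + dotv xi xi) `^ (s / 2))%:E)%E.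

Definition barron (s : R) : set (tempered R d) :=
  [set u | exists2 g, fourier_transform_is u g & (barron_integral s g < +oo)%E].

(* The function g is unique up to a null set, so this is the infimum of a
   singleton, or +oo if the Fourier transform of u is not a function. *)
Definition barron_norm (s : R) u : \bar R :=
  ereal_inf (barron_integral s @` [set g | fourier_transform_is u g]).

Definition support_fun f : set V := closure [set x | f x != 0].

Definition test_function Omega (phi : schwartz R d) : Prop :=
  compact (support_fun phi) /\ support_fun phi `<=` Omega.

Definition support_distribution u : set V :=
  [set x | forall U, open U -> U x ->
     exists2 phi, test_function U phi & u phi != 0].

Definition supported_in K : set (tempered R d) :=
  [set u | support_distribution u `<=` K].

Definition restriction_is Omega u f : Prop :=
  [/\ Cmeasurable Omega f,
      forall K, compact K -> K `<=` Omega -> Cintegrable K f &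
      forall phi, test_function Omega phi ->
        u phi = Cintegral Omega (fun x => f x * phi x)].

(* +oo if the restriction of u to Omega is not a function; otherwise that
   function is unique up to a null set. *)
Definition L2norm Omega u : \bar R :=
  ereal_inf [set ((\int[mu]_(x in Omega) (normc (f x) ^+ 2)%:E) `^ 2^-1)%E
            | f in [set f | restriction_is Omega u f]].

Definition bounded_domain Omega : Prop :=
  [/\ open Omega, connected Omega, Omega !=set0 & bounded_set Omega].

End distributions.

(* Main.v *)
From HB Require Import structures.
Require Import Defs.
From mathcomp Require Import all_boot all_order all_algebra.
From mathcomp Require Import all_classical all_reals all_analysis.
From mathcomp Require Import measurable_realfun.
From mathcomp.real_closed Require Import complex.
From mathcomp Require Import ring lra.

Set Implicit Arguments.
Unset Strict Implicit.
Unset Printing Implicit Defensive.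
Import Order.TTheory GRing.Theory Num.Theory.
Import numFieldNormedType.Exports.
Local Open Scope classical_set_scope.
Local Open Scope ring_scope.

(** Let [w] be the difference of two elements of the source set.  By the link
condition its [B^{-a}] norm is at most a multiple of the data misfit, and its
[B^p] norm is at most a multiple of [r].  Since [0] lies strictly between [-a]
and [p], these two bounds control the [L^1] norm of the Fourier transform [g]
of [w].  A distribution whose Fourier transform is integrable is a bounded
function, [f x = c^-1 * \int g xi * e^{i x.xi}], and a bounded function has a
finite [L^2] norm over the bounded set [Omega].

Two points carry the weight of the proof.

First, the definition of the Fourier transform of [w] only gives the value of
[w] at the Fourier transforms of Schwartz functions.  Identifying the
restriction of [w] to [Omega] with [f] therefore requires that every test
function be such a transform, which is Fourier inversion together with the fact
that the inverse transform of a test function is a Schwartz function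
([fourier_invft], [invft_schwartz]).  All the transforms are expressed by the
real integrals [osc f th xi = \int f y * cos (y.xi + th)]: the phases [0] and
[pi / 2] give, up to sign, the real and the imaginary parts, a partial derivative or a
multiplication by a coordinate only shifts the phase by [pi / 2] and replaces
[f] by another test function ([osc_derive], [osc_partial]), so a single family
of functions is stable under everything that the Schwartz seminorms involve.
Inversion is proved by the classical regularization, with a smooth cutoff in
place of a Gaussian ([inversion_regularized], [fourier_inversion]); the constant
[c] is not computed but only shown to be nonzero ([inversion_constant_neq0]).

Second, a Barron norm is an infimum over the functions that represent the
Fourier transform, so the function [g1] that is almost optimal in [B^{-a}] and
the function [g2] that is almost optimal in [B^p] may differ.  They are glued
along a smooth cutoff [k] in frequency: [k * g1 + (1 - k) * g2] still pairs
correctly with every test function, because the product of [k] and a Schwartz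
function is a test function, at which [g1] and [g2] agree ([splice_pairing]).
With a cutoff at [1 + |xi|^2 ~ tau] the glued function has an [L^1] norm of
order [tau^{a/2} * A + tau^{-p/2} * B], where [A] and [B] are the two Barron
integrals ([L2norm_split]).  The value of [tau] that makes both terms equal
yields the exponents of the theorem ([interpolation_balance]). *)

(** * Borel sets and Lebesgue measure of R^d *)

Section borel_rV.
Context {R : realType} {d : nat}.
Local Notation V := 'rV[R]_d.
Local Notation mu := (@lebesgue_rV R d).

Lemma measurable_box (A : 'I_d -> set R) : (forall i, measurable (A i)) ->
  measurable [set x : V | forall i, A i (x ord0 i)].
Proof.
move=> mA; rewrite (_ : [set _ | _] =
    \bigcap_(i : 'I_d) ((fun x : V => x ord0 i) @^-1` A i)); last first.
  by apply/seteqP; split=> x /= H i; [move=> _|]; exact: H.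
apply: fin_bigcap_measurable => // i _.
by rewrite -[X in measurable X]setTI; exact: measurable_coord.
Qed.

(** An open set is the union of the cubes with rational centres and radii
[1/(n+1)] that it contains, and there are countably many of them. *)
Lemma open_measurable_rV (U : set V) : open U -> measurable U.
Proof.
move=> oU.
pose B (q : 'rV[rat]_d * nat) : set V :=
  [set x : V | forall i, ball (ratr (q.1 ord0 i) : R) (q.2.+1%:R^-1 : R) (x ord0 i)].
have -> : U = \bigcup_(q in [set q | B q `<=` U]) B q.
  apply/seteqP; split=> [x Ux|x [q] /= BU /BU//].
  have /nbhs_ballP[e /= e0 xeU] := open_nbhs_nbhs (conj oU Ux).
  have [n n2e] : exists n : nat, n.+1%:R^-1 < e / 2.
    exists (Num.truncn (e / 2)^-1).
    rewrite invf_plt ?posrE ?divr_gt0 //.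
    by rewrite truncnS_gt.
  have /choice[q qx] : forall i : 'I_d, exists q : rat,
      `|x ord0 i - ratr q| < n.+1%:R^-1 :> R.
    move=> i; have n0 : (0 : R) < n.+1%:R^-1 by rewrite invr_gt0.
    have lt : x ord0 i - n.+1%:R^-1 < x ord0 i + n.+1%:R^-1.
      by rewrite ltrD2l gtrN.
    have [q] := rat_in_itvoo lt; rewrite in_itv /= => /andP[q1 q2].
    by exists q; rewrite distrC ltr_distl q1 q2.
  (* A point of the cube around the rational centre is within twice the radius of x. *)
  exists (\row_i q i, n) => /= [y /= By|i]; last first.
    by rewrite /ball /= mxE distrC; exact: qx.
  apply: xeU; split => // i j; rewrite (ord1 i) /ball /=.
  have := By j; rewrite /ball /= mxE => yq.
  rewrite (splitr e) (le_lt_trans (ler_distD (ratr (q j)) _ _)) //.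
  by rewrite ltrD // (lt_trans _ n2e).
rewrite bigcup_mkcond; apply: countable_bigcupT_measurable => // q.
case: ifPn => // _.
refine (@measurable_box (fun i : 'I_d =>
  ball (ratr (q.1 ord0 i) : R) (q.2.+1%:R^-1 : R)) _) => i.
by apply: open_measurable; exact: ball_open.
Qed.

Lemma closed_measurable_rV (K : set V) : closed K -> measurable K.
Proof. by move/closed_openC/open_measurable_rV/measurableC; rewrite setCK. Qed.

Lemma compact_measurable_rV (K : set V) : compact K -> measurable K.
Proof.
move=> cK; apply: closed_measurable_rV; apply: compact_closed cK.
exact: norm_hausdorff.
Qed.

Lemma continuous_measurable_rV (f : V -> R) :
  continuous f -> measurable_fun [set: V] f.
Proof.
move=> /continuousP cf; apply: (measurability _ (RGenOpens.measurableE R)).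
move=> _ [_ [a [b ->] <-]]; rewrite setTI; apply: open_measurable_rV.
exact/cf/interval_open.
Qed.

Definition box (B : R) : set V := [set x | forall i, x ord0 i \in `[- B, B]].

Lemma box_measurable B : measurable (box B).
Proof. exact: (@measurable_box (fun=> `[- B, B]%classic)). Qed.

Lemma box_compact B : compact (box B).
Proof.
by apply: (@rV_compact _ _ (fun=> `[- B, B]%classic)) => _; exact: segment_compact.
Qed.

Lemma lebesgue_box B : 0 <= B -> mu (box B) = ((B *+ 2) ^+ d)%:E.
Proof.
move=> B0; rewrite (@lebesgue_rV_box _ _ (fun=> `[- B, B]%classic)) //.
under eq_bigr do rewrite lebesgue_measure_itv /=.
have -> : (if (- B)%:E < B%:E then B%:E - (- B)%:E else 0)%E = (B *+ 2)%:E.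
  rewrite lte_fin -EFinD opprK -mulr2n; case: ifPn => //.
  rewrite -leNgt => BB; suff -> : B = 0 by rewrite mul0rn.
  by apply/eqP; rewrite eq_le B0 andbT; lra.
by rewrite prodEFin prodr_const card_ord.
Qed.

Lemma box_finite B : (mu (box B) < +oo)%E.
Proof.
have [B0|B0] := leP 0 B; first by rewrite lebesgue_box // ltry.
apply: le_lt_trans (_ : (mu (box 0) < +oo)%E); last by rewrite lebesgue_box // ltry.
apply: le_measure; rewrite ?inE; [exact: box_measurable|exact: box_measurable|].
move=> x /= xB i; have := xB i; rewrite !in_itv /= => /andP[h1 h2].
by apply/andP; split; lra.
Qed.

Lemma bounded_sub_box (A : set V) : bounded_set A -> exists B, A `<=` box B.
Proof.
move=> [M [Mreal AM]]; exists (M + 1) => x /AM xM i.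
have {}xM : `|x| <= M + 1 by apply: xM; rewrite ltrDl.
rewrite in_itv /= -ler_norml; apply: le_trans xM.
rewrite [leRHS]/Num.norm /= mx_normrE; apply/bigmax_geP; right => /=.
by exists (ord0, i).
Qed.

End borel_rV.

(** * Affine changes of variables *)

Section affine1.
Context {R : realType}.
Local Notation leb := (@lebesgue_measure R).
Variables (t e : R).
Hypothesis e0 : e != 0.

Let phi (x : measurableTypeR R) : measurableTypeR R := t + e * x.

Let mphi : measurable_fun [set: measurableTypeR R] phi.
Proof.
apply: continuous_measurable_fun => x; apply: cvgD; first exact: cvg_cst.
exact: mulrl_continuous.
Qed.

Let phi_mixin := isMeasurableFun.Build _ _ _ _ _ mphi.
Let phi_pack : {mfun _ >-> _} := HB.pack phi phi_mixin.

Let phi_itv a b :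
  leb (phi @^-1` `]a, b]) = (if a < b then (`|e|^-1 * (b - a))%:E else 0%E).
Proof.
have [epos|eneg] := ltP 0 e.
  have -> : phi @^-1` `]a, b] = `](a - t) / e, (b - t) / e]%classic.
    apply/seteqP; split=> x /=; rewrite !in_itv /= ltr_pdivrMr // ler_pdivlMr //;
      by rewrite /phi => /andP[h1 h2]; apply/andP; split; lra.
  rewrite lebesgue_measure_itv /= lte_fin ltr_pM2r ?invr_gt0 // ltrD2r.
  case: ifPn => // _; rewrite -EFinD gtr0_norm //; congr EFin.
  by field.
have {}eneg : e < 0 by rewrite lt_neqAle e0.
have -> : phi @^-1` `]a, b] = `[(b - t) / e, (a - t) / e[%classic.
  apply/seteqP; split=> x /=; rewrite !in_itv /= ltr_ndivlMr // ler_ndivrMr //;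
    by rewrite /phi => /andP[h1 h2]; apply/andP; split; lra.
rewrite lebesgue_measure_itv /= lte_fin ltr_nM2r ?invr_lt0 // ltrD2r.
case: ifPn => // _; rewrite -EFinD ltr0_norm //; congr EFin.
by field.
Qed.

(** The image of Lebesgue measure under an affine map, rescaled by the slope, gives
half-open intervals their length, and this characterizes Lebesgue measure. *)
Lemma ge0_integral_affine1 (f : R -> \bar R) :
  measurable_fun [set: R] f -> (forall x, 0 <= f x)%E ->
  (\int[leb]_x f (t + e * x)%R = (`|e|^-1)%:E * \int[leb]_x f x)%E.
Proof.
move=> mf f0.
have <- := @ge0_integral_pushforward _ _ _ _ _ phi mphi leb setT f measurableT
   mf (fun y _ => f0 y).
have ee : 0 <= `|e| by [].
have -> : (\int[leb]_x f x = `|e|%:E * \int[pushforward leb phi]_x f x)%E.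
  rewrite -(@ge0_integral_mscale _ _ _ (pushforward leb phi_pack) _ measurableT
    (NngNum ee) f mf) //.
  apply: eq_measure_integral => A mA _.
  apply: (lebesgue_measure_unique (mu := mscale (NngNum ee) (pushforward leb phi_pack))) => //.
  move=> _ [[a b]] _ <-; 
  transitivity (`|e|%:E * leb (phi @^-1` `]a, b]))%E; last by [].
  rewrite phi_itv.
  rewrite lebesgue_measure_itv /= lte_fin; case: ifPn => _; last by rewrite mule0.
  by rewrite -EFinD -EFinM mulrA mulfV ?normr_eq0 // mul1r.
by rewrite muleA -EFinM mulVf ?normr_eq0 // mul1e.
Qed.

End affine1.

Section lebesgue_rV_integral.
Context {R : realType}.
Local Notation leb := (@lebesgue_measure R).

(** Tonelli along the first coordinate; the inductions on the dimension below rest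
on it. *)
Lemma ge0_integral_rV_cons d (f : 'rV[R]_d.+1 -> \bar R) :
  measurable_fun [set: 'rV[R]_d.+1] f -> (forall x, 0 <= f x)%E ->
  (\int[lebesgue_rV d.+1]_x f x =
   \int[leb]_a \int[lebesgue_rV d]_x f (rV_cons (a, x)))%E.
Proof.
move=> mf f0.
transitivity (\int[(leb \x lebesgue_rV d)%E]_z f (rV_cons z))%E.
  have := @ge0_integral_pushforward _ _ (measurableTypeR R * 'rV[R]_d)%type
    'rV[R]_d.+1 R (@rV_cons R d) (@measurable_rV_cons R d)
    (leb \x lebesgue_rV d)%E setT f measurableT mf (fun y _ => f0 y).
  rewrite preimage_setT; exact.
rewrite fubini_tonelli1 //.
by apply: measurableT_comp => //; exact: measurable_rV_cons.
Qed.

Lemma measurable_fun_rV_cons2 d d1 (T : measurableType d1)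
   (f : 'rV[R]_d.+1 -> T) (a : R) :
  measurable_fun setT f -> measurable_fun setT (fun x : 'rV[R]_d => f (rV_cons (a, x))).
Proof.
move=> mf; apply: measurableT_comp => //.
apply: measurableT_comp; first exact: measurable_rV_cons.
exact: measurable_pair1.
Qed.

Lemma measurable_affine d (t : 'rV[R]_d) (e : R) :
  measurable_fun setT (fun x : 'rV[R]_d => t + e *: x).
Proof.
apply: measurable_fun_rVP => i.
apply: (eq_measurable_fun (fun x : 'rV[R]_d => t ord0 i + e * x ord0 i)).
  by move=> x _; rewrite !mxE.
apply: measurable_funD => //; apply: measurable_funM => //.
exact: measurable_coord.
Qed.

(** Induction on the dimension, one coordinate at a time. *)
Lemma ge0_integral_affine d (t : 'rV[R]_d) (e : R) (f : 'rV[R]_d -> \bar R) :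
  e != 0 -> measurable_fun setT f -> (forall x, 0 <= f x)%E ->
  (\int[lebesgue_rV d]_x f (t + e *: x)%R =
   (`|e|^-1 ^+ d)%:E * \int[lebesgue_rV d]_x f x)%E.
Proof.
move=> e0; elim: d t f => [|d IH] t f mf f0.
  rewrite expr0 mul1e; apply: eq_integral => x _; congr f.
  by apply/rowP => -[].
rewrite ge0_integral_rV_cons //; last first.
  by apply: measurableT_comp => //; exact: measurable_affine.
have [t0 [t' tE]] : exists t0 t', t = rV_cons (t0, t').
  by exists (rV_uncons t).1, (rV_uncons t).2; rewrite -surjective_pairing rV_unconsK.
have E a x : t + e *: rV_cons (a, x) = rV_cons (t0 + e * a, t' + e *: x).
  rewrite tE; apply/rowP => i; rewrite !mxE.
  by case: splitP => j _; rewrite !mxE.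
pose g a := (\int[lebesgue_rV d]_x f (rV_cons (a, x)))%E.
have mg : measurable_fun setT g.
  apply: (@measurable_fun_fubini_tonelli_F _ _ (measurableTypeR R) 'rV[R]_d R
    (lebesgue_rV d) (f \o @rV_cons R d)) => [|x]; last exact: f0.
  by apply: measurableT_comp => //; exact: measurable_rV_cons.
have g0 a : (0 <= g a)%E by apply: integral_ge0.
have c0 : 0 <= `|e|^-1 ^+ d by rewrite exprn_ge0 ?invr_ge0.
transitivity (\int[leb]_a ((`|e|^-1 ^+ d)%:E * g (t0 + e * a)%R))%E.
  apply: eq_integral => a _; rewrite /g -(IH t' (fun x => f (rV_cons (t0 + e * a, x)))) //.
    by apply: eq_integral => x _; rewrite E.
  exact: measurable_fun_rV_cons2.
rewrite ge0_integralZl //; last first.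
  apply: (measurableT_comp mg); apply: continuous_measurable_fun => x.
  by apply: cvgD; [exact: cvg_cst|exact: mulrl_continuous].
rewrite (ge0_integral_affine1 _ e0 mg) // ge0_integral_rV_cons //.
by rewrite muleA -EFinM exprSr.
Qed.

End lebesgue_rV_integral.

(** * Domination, Fubini and integrals over R^d *)

Section integration.
Context d (T : measurableType d) {R : realType} (m : {measure set T -> \bar R}).
Implicit Types f g : T -> R.
Local Notation intg f := (m.-integrable setT (EFin \o f)).

Lemma integrable_le f g : measurable_fun setT f ->
  (forall x, `|f x| <= g x) -> intg g -> intg f.
Proof.
move=> mf fg ig; apply: le_integrable ig => //; first exact/measurable_EFinP.
by move=> x _ /=; rewrite lee_fin (le_trans (fg x)) // ler_norm.
Qed.

Lemma integrable_measurable f : intg f -> measurable_fun setT f.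
Proof. by move=> /measurable_int /measurable_EFinP. Qed.

Lemma integrable_normr f : intg f -> intg (fun x => `|f x|).
Proof. by move=> /integrable_norm. Qed.

Lemma integrable_mul_bounded f g (c : R) : measurable_fun setT g ->
  (forall x, `|g x| <= c) -> intg f -> intg (fun x => f x * g x).
Proof.
move=> mg gc fi.
have c0 : 0 <= c by exact: le_trans (gc point).
apply: (@integrable_le _ (fun x => c * `|f x|)).
- by apply: measurable_funM => //; exact: integrable_measurable.
- by move=> x; rewrite normrM mulrC ler_wpM2r.
- have /(integrableZl measurableT c) : intg (fun x => `|f x|) by exact: integrable_normr.
  exact.
Qed.

Lemma Rintegral_dominated (f_ : nat -> T -> R) f g :
  (forall n, measurable_fun setT (f_ n)) ->
  (forall x, f_ n x @[n --> \oo] --> f x) ->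
  (forall n x, `|f_ n x| <= g x) -> intg g ->
  \int[m]_x f_ n x @[n --> \oo] --> \int[m]_x f x.
Proof.
move=> mf_ ff fg ig.
have mf : measurable_fun setT f.
  by apply: (measurable_fun_cvg mf_) => x _; exact: ff.
have fi : intg f.
  apply: integrable_le mf _ ig => x.
  apply: (cvgr_to_le (cvg_norm (ff x))).
  by apply: nearW => n; exact: fg.
have cv x : setT x -> (f_ n x)%:E @[n --> \oo] --> (f x)%:E.
  by move=> _; apply: cvg_EFin; [exact: nearW|exact: ff].
have [_ _] := @dominated_convergence _ _ _ m setT measurableT
  (fun n => EFin \o f_ n) (EFin \o f) (EFin \o g)
  (fun n => (measurable_EFinP _ _).2 (mf_ n)) ((measurable_EFinP _ _).2 mf)
  (aeW _ cv) ig
  (aeW _ (fun x n _ => fg n x)).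
move=> H; apply: fine_cvg.
by rewrite fineK //; exact: integrable_fin_num.
Qed.

End integration.

Section bounded_fubini.
Context d1 d2 (T1 : measurableType d1) (T2 : measurableType d2) {R : realType}.
Variables (m1 : {sigma_finite_measure set T1 -> \bar R})
  (m2 : {sigma_finite_measure set T2 -> \bar R}).
Variables (F : T1 * T2 -> R) (a : T1 -> R) (b : T2 -> R).
Hypothesis mF : measurable_fun setT F.
Hypothesis Fab : forall x y, `|F (x, y)| <= a x * b y.
Hypothesis a0 : forall x, 0 <= a x.
Hypothesis b0 : forall x, 0 <= b x.
Hypothesis ai : m1.-integrable setT (EFin \o a).
Hypothesis bi : m2.-integrable setT (EFin \o b).

Lemma fubini_integrable1 x : m2.-integrable setT (EFin \o (fun y => F (x, y))).
Proof.
apply: (@integrable_le _ _ _ _ _ (fun y => a x * b y)) => //.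
  exact: measurableT_comp mF (measurable_pair1 x).
exact: (integrableZl measurableT (a x) bi).
Qed.

Lemma fubini_integrable2 y : m1.-integrable setT (EFin \o (fun x => F (x, y))).
Proof.
apply: (@integrable_le _ _ _ _ _ (fun x => b y * a x)) => //.
- exact: measurableT_comp mF (measurable_pair2 y).
- by move=> x; rewrite mulrC.
- exact: (integrableZl measurableT (b y) ai).
Qed.

Let Fi : (m1 \x m2)%E.-integrable setT (EFin \o F).
Proof.
apply/integrable12ltyP; first exact/measurable_EFinP.
have ib : (\int[m2]_y (b y)%:E < +oo)%E.
  rewrite -ge0_fin_numE; first exact: integrable_fin_num bi.
  by apply: integral_ge0 => x _; rewrite lee_fin.
have ia : (\int[m1]_y (a y)%:E < +oo)%E.
  rewrite -ge0_fin_numE; first exact: integrable_fin_num ai.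
  by apply: integral_ge0 => x _; rewrite lee_fin.
apply: (@le_lt_trans _ _ (\int[m1]_x ((a x)%:E * \int[m2]_y (b y)%:E))%E).
  apply: ge0_le_integral => //=.
  - by move=> x _; apply: integral_ge0.
  - apply: (@measurable_fun_fubini_tonelli_F _ _ _ _ _ m2 (fun z => `|F z|%:E)) => //.
    by apply/measurable_EFinP; apply: measurableT_comp.
  - by apply: emeasurable_funM => //; exact: (measurable_int _ ai).
  move=> x _; rewrite -ge0_integralZl ?lee_fin //; last 2 first.
  - exact: (measurable_int _ bi).
  - by move=> y _; rewrite lee_fin.
  apply: ge0_le_integral => //=.
  - by apply/measurable_EFinP; apply: measurableT_comp => //; exact: measurableT_comp mF (measurable_pair1 x).
  - by apply: measurable_funeM; exact: (measurable_int _ bi).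
  by move=> y _; rewrite lee_fin.
rewrite ge0_integralZr //; last 3 first.
- exact: (measurable_int _ ai).
- by move=> x _; rewrite lee_fin.
- by apply: integral_ge0 => y _; rewrite lee_fin.
by rewrite lte_mul_pinfty // ?integral_ge0 // => [x _|]; rewrite ?lee_fin // ge0_fin_numE // integral_ge0 // => x _; rewrite lee_fin.
Qed.

Lemma bounded_fubini_integrable1 : m1.-integrable setT (EFin \o (fun x => \int[m2]_y F (x, y))).
Proof.
have := integrable_fubini_F Fi; congr (_.-integrable _ _); apply/funext => x /=.
rewrite /fubini_F /Rintegral fineK //; exact: integrable_fin_num (fubini_integrable1 x).
Qed.

Lemma bounded_fubini :
  \int[m1]_x \int[m2]_y F (x, y) = \int[m2]_y \int[m1]_x F (x, y).
Proof.
have := Fubini Fi.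
rewrite /Rintegral => E; congr fine; rewrite (eq_integral (fun x => \int[m2]_y (F (x, y))%:E)%E).
  rewrite E; apply: eq_integral => y _; rewrite fineK //.
  exact: integrable_fin_num (fubini_integrable2 y).
by move=> x _; rewrite fineK //; exact: integrable_fin_num (fubini_integrable1 x).
Qed.

End bounded_fubini.

Section integration_rV.
Context {R : realType} {d : nat}.
Local Notation V := 'rV[R]_d.
Local Notation mu := (@lebesgue_rV R d).
Implicit Types f : V -> R.
Local Notation intg f := (mu.-integrable setT (EFin \o f)).

Lemma integrable_affine (t : V) (e : R) f : e != 0 ->
  intg f -> intg (fun x => f (t + e *: x)).
Proof.
move=> e0 fi; have mf := integrable_measurable fi.
apply/integrableP; split.
  by apply/measurable_EFinP; apply: measurableT_comp mf _; exact: measurable_affine.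
have := @ge0_integral_affine R d t e (fun x => `|f x|%:E) e0.
move=> /= -> //; last first.
  by apply/measurable_EFinP; apply: measurableT_comp.
by case/integrableP : fi => _ fi; rewrite lte_mul_pinfty // lee_fin exprn_ge0 // invr_ge0.
Qed.

(** Splits [f] into its positive and negative parts. *)
Lemma Rintegral_affine (t : V) (e : R) f : e != 0 -> intg f ->
  \int[mu]_x f (t + e *: x) = `|e|^-1 ^+ d * \int[mu]_x f x.
Proof.
move=> e0 fi; have mf : measurable_fun setT (EFin \o f) := measurable_int _ fi.
rewrite /Rintegral.
have -> : (\int[mu]_x (f (t + e *: x)%R)%:E =
    (`|e|^-1 ^+ d)%:E * \int[mu]_x (f x)%:E)%E.
  rewrite integralE [in RHS]integralE.
  have -> : (\int[mu]_x (fun x : V => (f (t + e *: x)%R)%:E)^\+ x = 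
      (`|e|^-1 ^+ d)%:E * \int[mu]_x (EFin \o f)^\+ x)%E.
    rewrite -(ge0_integral_affine t e0 (measurable_funepos mf) (funepos_ge0 _)).
    by apply: eq_integral => x _; rewrite !funeposE.
  have -> : (\int[mu]_x (fun x : V => (f (t + e *: x)%R)%:E)^\- x = 
      (`|e|^-1 ^+ d)%:E * \int[mu]_x (EFin \o f)^\- x)%E.
    rewrite -(ge0_integral_affine t e0 (measurable_funeneg mf) (funeneg_ge0 _)).
    by apply: eq_integral => x _; rewrite !funenegE.
  by apply/esym/muleBr => //; apply/fin_num_adde_defr/integrable_pos_fin_num.
by rewrite fineM //; exact: integrable_fin_num.
Qed.

Lemma Rintegral_translate (t : V) f : intg f -> \int[mu]_x f (t + x) = \int[mu]_x f x.
Proof.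
move=> fi; have := Rintegral_affine t (oner_neq0 R) fi.
rewrite normr1 invr1 expr1n mul1r => <-.
by apply: eq_Rintegral => x _; rewrite scale1r.
Qed.

Lemma Rintegral_reflect f : intg f -> \int[mu]_x f (- x) = \int[mu]_x f x.
Proof.
move=> fi; have := @Rintegral_affine 0 (-1) f.
rewrite oppr_eq0 oner_eq0 normrN1 invr1 expr1n mul1r => <- //.
by apply: eq_Rintegral => x _; rewrite add0r scaleN1r.
Qed.

Lemma dotv_ge0 (x : V) : 0 <= dotv x x.
Proof. by apply: sumr_ge0 => i _; rewrite -expr2 sqr_ge0. Qed.

Lemma dotvC (x y : V) : dotv x y = dotv y x.
Proof. by apply: eq_bigr => i _; rewrite mulrC. Qed.

Lemma dotvDl (x y z : V) : dotv (x + y) z = dotv x z + dotv y z.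
Proof. by rewrite /dotv -big_split; apply: eq_bigr => i _; rewrite mxE mulrDl. Qed.

Lemma dotvDr (x y z : V) : dotv z (x + y) = dotv z x + dotv z y.
Proof. by rewrite ![dotv z _]dotvC dotvDl. Qed.

Lemma dotvZl (a : R) (x z : V) : dotv (a *: x) z = a * dotv x z.
Proof. by rewrite /dotv mulr_sumr; apply: eq_bigr => i _; rewrite mxE mulrA. Qed.

Lemma dotvZr (a : R) (x z : V) : dotv z (a *: x) = a * dotv z x.
Proof. by rewrite dotvC dotvZl dotvC. Qed.

Lemma dotvNl (x z : V) : dotv (- x) z = - dotv x z.
Proof. by rewrite -scaleN1r dotvZl mulN1r. Qed.

Lemma dotv_delta (x : V) i : dotv x (delta_mx ord0 i) = x ord0 i.
Proof.
rewrite /dotv (bigD1 i) //= mxE !eqxx mulr1 big1 ?addr0 // => j ji.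
by rewrite mxE (negbTE ji) andbF mulr0.
Qed.

Lemma measurable_dotv d1 (T : measurableType d1) (f g : T -> V) :
  measurable_fun setT f -> measurable_fun setT g ->
  measurable_fun setT (fun x => dotv (f x) (g x)).
Proof.
move=> mf mg; apply: measurable_sum => i; apply: measurable_funM.
  exact: (measurableT_comp (@measurable_coord _ _ i)).
exact: (measurableT_comp (@measurable_coord _ _ i)).
Qed.

End integration_rV.

Section japanese_bracket.
Context {R : realType}.

(** The integral is the [d]-th power of the integral of [1 / (1 + a ^+ 2)], which
is [pi].  It makes every function of rapid decay integrable. *)
Lemma integral_prod_oneDsqrV d :
  (\int[lebesgue_rV d]_x (\prod_(i < d) (1 + x ord0 i ^+ 2)^-1 : R)%:E < +oo)%E.
Proof.
have w0 (a : R) : 0 <= (1 + a ^+ 2)^-1 by rewrite invr_ge0 addr_ge0 ?sqr_ge0.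
have cw : continuous (fun a : R => (1 + a ^+ 2)^-1) by exact: continuous_oneDsqrV.
have p0 n (x : 'rV[R]_n) : 0 <= \prod_(i < n) (1 + x ord0 i ^+ 2)^-1.
  by apply: prodr_ge0 => i _.
have mp n : measurable_fun setT (fun x : 'rV[R]_n =>
    (\prod_(i < n) (1 + x ord0 i ^+ 2)^-1)%:E).
  apply/measurable_EFinP; apply: measurable_prod => i _.
  apply: (measurableT_comp (f := fun a : R => (1 + a ^+ 2)^-1)).
    exact: continuous_measurable_fun.
  exact: measurable_coord.
elim: d => [|d IH].
  under eq_integral do rewrite big_ord0.
  by rewrite integral_cst //= diracT mul1e ltry.
rewrite ge0_integral_rV_cons //; last by move=> x; rewrite lee_fin.
have E (a : R) (x : 'rV[R]_d) :
    \prod_(i < d.+1) (1 + (rV_cons (a, x)) ord0 i ^+ 2)^-1 =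
    (1 + a ^+ 2)^-1 * \prod_(i < d) (1 + x ord0 i ^+ 2)^-1.
  have [ea ex] := rV_consK (a, x).
  rewrite big_ord_recl ea; congr (_ * _); apply: eq_bigr => i _.
  by rewrite -[in RHS]ex mxE.
have I0 : (0 <= \int[lebesgue_rV d]_x (\prod_(i < d) (1 + x ord0 i ^+ 2)^-1 : R)%:E)%E.
  by apply: integral_ge0 => x _; rewrite lee_fin.
set I := (\int[lebesgue_rV d]_x _)%E in IH I0.
rewrite (_ : integral _ _ _ =
    \int[@lebesgue_measure R]_a (((1 + a ^+ 2)^-1)%:E * I))%E; last first.
  apply: eq_integral => a _; rewrite /I -ge0_integralZl ?lee_fin //.
    by apply: eq_integral => x _; rewrite E EFinM.
    exact: mp.
  by move=> x _; rewrite lee_fin; exact: p0.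
rewrite ge0_integralZr //; last 2 first.
- by apply/measurable_EFinP; exact: continuous_measurable_fun.
- by move=> x _; rewrite lee_fin.
rewrite lte_mul_pinfty //.
- by apply: integral_ge0 => x _; rewrite lee_fin.
- rewrite ge0_fin_numE; last by apply: integral_ge0 => x _; rewrite lee_fin.
  rewrite ge0_symfun_integralT //; last by move=> x /=; rewrite sqrrN.
  rewrite (_ : [set x | _] = `[0, +oo[%classic); last first.
    by apply/seteqP; split => x/=; rewrite in_itv/= andbT.
  have -> := @integral0y_oneDsqr R.
  by rewrite -EFinM ltry.
Qed.

End japanese_bracket.

(** * Smooth real functions *)

Section smooth_real_functions.
Context {R : realType} {d : nat}.
Local Notation V := 'rV[R]_d.
Local Notation e_ i := (delta_mx ord0 i : V).
Implicit Types (f g h : V -> R) (S : set (V -> R)).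

Definition rpartial (i : 'I_d) f : V -> R := fun x => 'D_(e_ i) f x.

Definition rpartials (s : seq 'I_d) f : V -> R := foldr rpartial f s.

Definition C1 f := continuous f /\ forall i x, derivable f x (e_ i).

Definition rsmooth f : Prop := forall s, C1 (rpartials s f).

Lemma rpartials_rcons s i f : rpartials (rcons s i) f = rpartials s (rpartial i f).
Proof. by rewrite /rpartials foldr_rcons. Qed.

(** Smoothness is proved coinductively: it is enough to exhibit a set of [C1]
functions that is closed under partial derivatives. *)
Lemma rsmooth_coind S :
  (forall g, S g -> C1 g /\ forall i, S (rpartial i g)) ->
  forall f, S f -> rsmooth f.
Proof.
move=> SP f Sf s; suff /SP[] : S (rpartials s f) by [].
by elim: s => //= i s /SP[_]; exact.
Qed.

Lemma rsmooth_partial f i : rsmooth f -> rsmooth (rpartial i f).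
Proof. by move=> sf s; rewrite -rpartials_rcons; exact: sf. Qed.

Lemma rsmooth_C1 f : rsmooth f -> C1 f.
Proof. by move=> /(_ [::]). Qed.

(** The algebra of functions generated by [S].  By the Leibniz rule it is closed
under partial derivatives as soon as it contains those of its generators, which
makes it a convenient set for [rsmooth_coind]. *)
Inductive alg S : set (V -> R) :=
| alg_gen g : S g -> alg S g
| alg_cst c : alg S (cst c)
| alg_add f g : alg S f -> alg S g -> alg S (f + g)
| alg_mul f g : alg S f -> alg S g -> alg S (f * g).

Lemma rpartial_cst i (c : R) : rpartial i (cst c) = cst 0.
Proof. by apply/funext => x; rewrite /rpartial derive_cst. Qed.

Lemma rpartialD i f g : C1 f -> C1 g -> rpartial i (f + g) = rpartial i f + rpartial i g.
Proof. by move=> [_ df] [_ dg]; apply/funext => x; rewrite /rpartial deriveD. Qed.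

Lemma rpartialM i f g : C1 f -> C1 g ->
  rpartial i (f * g) = f * rpartial i g + g * rpartial i f.
Proof. by move=> [_ df] [_ dg]; apply/funext => x; rewrite /rpartial deriveM. Qed.

Lemma C1_cst (c : R) : C1 (cst c).
Proof. by split=> [|i x]; [exact: cst_continuous|exact: derivable_cst]. Qed.

Lemma C1D f g : C1 f -> C1 g -> C1 (f + g).
Proof.
move=> [cf df] [cg dg]; split=> [x|i x]; first exact: continuousD (cf x) (cg x).
exact: derivableD (df i x) (dg i x).
Qed.

Lemma C1M f g : C1 f -> C1 g -> C1 (f * g).
Proof.
move=> [cf df] [cg dg]; split=> [x|i x]; first exact: continuousM (cf x) (cg x).
exact: derivableM (df i x) (dg i x).
Qed.

Lemma alg_smooth S : (forall g, S g -> C1 g /\ forall i, alg S (rpartial i g)) ->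
  forall f, alg S f -> rsmooth f.
Proof.
move=> SP; apply: rsmooth_coind => f; elim => {f} [g /SP//|c|f g af [Cf pf] ag [Cg pg]|
    f g af [Cf pf] ag [Cg pg]].
- by split=> [|i]; [exact: C1_cst|rewrite rpartial_cst; exact: alg_cst].
- by split=> [|i]; [exact: C1D|rewrite rpartialD //; exact: alg_add].
- split=> [|i]; first exact: C1M.
  by rewrite rpartialM //; apply: alg_add; exact: alg_mul.
Qed.

Lemma rsmooth_alg f : alg rsmooth f -> rsmooth f.
Proof.
apply: alg_smooth => g sg; split=> [|i]; first exact: rsmooth_C1.
by apply: alg_gen; exact: rsmooth_partial.
Qed.

Lemma rsmooth_cst (c : R) : rsmooth (cst c).
Proof. by apply: rsmooth_alg; exact: alg_cst. Qed.

Lemma rsmoothD f g : rsmooth f -> rsmooth g -> rsmooth (f + g).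
Proof. by move=> sf sg; apply: rsmooth_alg; apply: alg_add; exact: alg_gen. Qed.

Lemma rsmoothM f g : rsmooth f -> rsmooth g -> rsmooth (f * g).
Proof. by move=> sf sg; apply: rsmooth_alg; apply: alg_mul; exact: alg_gen. Qed.

Lemma diff_quotient_line f (x v : V) :
  (fun h : R => h^-1 *: ((f \o shift x) (h *: v) - f x)) =
  (fun h : R => h^-1 *: (((fun t : R => f (t *: v + x)) \o shift 0) (h *: 1)
                        - f (0 *: v + x))).
Proof. by apply/funext => h /=; rewrite addr0 scale0r add0r [h%:A]mulr1. Qed.

(** A directional derivative is a derivative along a line, so that the theory of
derivatives of functions of one variable applies. *)
Lemma derivable_line f (x v : V) (l : R) :
  derivable f x v /\ 'D_v f x = l <->
  is_derive (0 : R) 1 (fun t : R => f (t *: v + x)) l.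
Proof.
rewrite /derivable /derive diff_quotient_line; split=> [[? ?]|[]]; last by [].
exact: DeriveDef.
Qed.

Lemma derivable_shift_line f (x v : V) (t : R) :
  derivable f (t *: v + x) v ->
  is_derive t 1 (fun t : R => f (t *: v + x)) ('D_v f (t *: v + x)).
Proof.
move=> df; have [df' E] : derivable (fun u : R => f (u *: v + x)) t 1 /\
    'D_1 (fun u : R => f (u *: v + x)) t = 'D_v f (t *: v + x).
  rewrite /derivable /derive.
  suff -> : (fun h : R => h^-1 *: (((fun u : R => f (u *: v + x)) \o shift t) (h *: 1) -
      f (t *: v + x))) = (fun h : R => h^-1 *: ((f \o shift (t *: v + x)) (h *: v) -
      f (t *: v + x))) by split.
  by apply/funext => h /=; rewrite [h%:A]mulr1 scalerDl addrA.
exact: DeriveDef.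
Qed.

Lemma rsmooth_coord (j : 'I_d) : rsmooth (fun x : V => x ord0 j).
Proof.
have D i (x : V) : derivable (fun x : V => x ord0 j) x (e_ i) /\
    'D_(e_ i) (fun x : V => x ord0 j) x = (e_ i) ord0 j.
  apply/derivable_line.
  have -> : (fun t : R => (t *: e_ i + x) ord0 j) =
      (fun t : R => t * e_ i ord0 j + x ord0 j).
    by apply/funext => t; rewrite !mxE.
  by apply: is_derive_eq; rewrite /GRing.scale /=; ring.
apply: (@alg_smooth [set (fun x : V => x ord0 j)]); last exact: alg_gen.
move=> _ ->; split=> [|i]; first by split; [exact: coord_continuous|move=> i x; case: (D i x)].
have -> : rpartial i (fun x : V => x ord0 j) = cst ((e_ i) ord0 j).
  by apply/funext => x; case: (D i x).
exact: alg_cst.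
Qed.

Lemma rsmooth_sum (I : Type) (s : seq I) (F : I -> V -> R) :
  (forall i, rsmooth (F i)) -> rsmooth (fun x => \sum_(i <- s) F i x).
Proof.
move=> sF; elim: s => [|i s IH].
  rewrite (_ : (fun _ => _) = cst 0); first exact: rsmooth_cst.
  by apply/funext => y; rewrite big_nil.
rewrite (_ : (fun _ => _) = F i + (fun x => \sum_(j <- s) F j x)).
  exact: rsmoothD.
by apply/funext => y; rewrite big_cons.
Qed.

Lemma rsmooth_dotv : rsmooth (fun x : V => dotv x x).
Proof. by apply: rsmooth_sum => i; apply: rsmoothM; exact: rsmooth_coord. Qed.

End smooth_real_functions.

(** * A smooth cutoff *)

Section flat_functions.
Context {R : realType}.
Implicit Types t : R.

(** The derivatives of [exp (-1/t)], extended by [0] to [t <= 0], are linear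
combinations of these functions. *)
Definition flat (k : nat) t : R := if 0 < t then t^-1 ^+ k * expR (- t^-1) else 0.

Lemma flat_le0 k t : t <= 0 -> flat k t = 0.
Proof. by move=> t0; rewrite /flat ltNge t0. Qed.

Lemma flat_gt0 k t : 0 < t -> flat k t = t^-1 ^+ k * expR (- t^-1).
Proof. by move=> t0; rewrite /flat t0. Qed.

Lemma flat_ge0 k t : 0 <= flat k t.
Proof.
have [t0|t0] := leP t 0; first by rewrite flat_le0.
by rewrite flat_gt0 // mulr_ge0 ?expR_ge0 // exprn_ge0 // invr_ge0 ltW.
Qed.

(** As [expR y] dominates [y ^+ n.+1 / n.+1`!], these functions vanish to infinite
order at [0]. *)
Lemma flat_le k n t : 0 <= t -> flat k t <= (k + n.+1)`!%:R * t ^+ n.+1.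
Proof.
rewrite le_eqVlt => /predU1P[<-|t0].
  by rewrite flat_le0 // mulr_ge0 // exprn_ge0.
rewrite flat_gt0 // expRN ler_pdivrMr ?expR_gt0 // addnS.
have := @expR_ge1Dxn R t^-1 (k + n) (ltac:(by rewrite invr_ge0 ltW)).
move=> H; have {}H : t^-1 ^+ (k + n).+1 <= (k + n).+1`!%:R * expR t^-1.
  rewrite mulrC -ler_pdivrMr ?ltr0n ?fact_gt0 //.
  by apply: le_trans H; rewrite lerDr.
rewrite mulrAC -ler_pdivrMr ?exprn_gt0 //; apply: le_trans H.
by rewrite -exprVn -exprD addnS.
Qed.

(** The family is closed under differentiation.  At [0] the difference quotient is
at most [(k + 2)`! * |h|] by [flat_le]. *)
Lemma is_derive_flat k t :
  is_derive t 1 (flat k) (flat k.+2 t - k%:R * flat k.+1 t).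
Proof.
have [t0|t0|<-] := ltgtP 0 t.
- have t_neq0 : t != 0 by rewrite gt_eqF.
  apply: (@near_eq_is_derive _ _ _ (fun u : R => u^-1 ^+ k * expR (- u^-1))).
    near=> u; rewrite flat_gt0 //; near: u; exact: lt_nbhsr.
  have dV : is_derive t 1 (fun u : R => u^-1) (- t ^- 2).
    by apply: is_derive_eq; [exact: is_deriveV|rewrite /GRing.scale /= mulr1].
  have dN : is_derive t 1 (fun u : R => - u^-1) (t ^- 2).
    by apply: is_derive_eq; rewrite opprK.
  have dE := @is_derive1_comp R expR (fun u => - u^-1) t _ _ (is_derive_expR (- t^-1)) dN.
  have dX := is_deriveX k dV; rewrite exprfctE /= in dX.
  have := is_deriveM dX dE; rewrite /GRing.scale /= => H.
  apply: (is_derive_eq (f := fun u : R => u^-1 ^+ k * expR (- u^-1)) H).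
  rewrite !flat_gt0 // -exprVn; case: (k) => [|j] /=; rewrite !exprS; ring.
- have D0 : is_derive t 1 (cst (0 : R)) 0 by exact: is_derive_cst.
  rewrite !flat_le0 ?(ltW t0) // mulr0 subr0.
  apply: near_eq_is_derive D0.
  by near=> u; rewrite flat_le0 // ltW //; near: u; exact: lt_nbhsl.
- rewrite !flat_le0 // mulr0 subr0.
  suff H : (fun h : R => h^-1 *: ((flat k \o shift 0) (h *: 1) - flat k 0)) h
      @[h --> 0^'] --> (0 : R).
    by apply: DeriveDef; [apply/cvg_ex; exists 0|apply/cvg_lim].
  have N0 : `|h| @[h --> (0 : R)^'] --> (0 : R).
    apply/cvgr0Pnorm_lt => e e0; near=> h; rewrite normr_id.
    by near: h; exact: dnbhs0_lt.
  apply: (@squeeze_cvgr _ _ _ _ (fun h => - ((k + 2)`!%:R * `|h|))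
    (fun h => (k + 2)`!%:R * `|h|)).
  + near=> h; rewrite /= addr0 [h%:A]mulr1 (@flat_le0 k 0) // subr0 -ler_norml normrZ.
    rewrite normfV ler_pdivrMl; last first.
      by rewrite normr_gt0; near: h; exact: nbhs_dnbhs_neq.
    rewrite ger0_norm ?flat_ge0 //.
    have [h0|h0] := leP h 0; first by rewrite flat_le0 // !mulr_ge0.
    rewrite (gtr0_norm h0) mulrCA -expr2; exact: flat_le (ltW h0).
  + rewrite -[X in _ --> X]oppr0; apply: cvgN.
    rewrite -[X in _ --> X](mulr0 (k + 2)`!%:R); apply: cvgM; first exact: cvg_cst.
    exact: N0.
  + rewrite -[X in _ --> X](mulr0 (k + 2)`!%:R); apply: cvgM; first exact: cvg_cst.
    exact: N0.
Unshelve. all: by end_near. Qed.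

Lemma continuous_flat k : continuous (flat k).
Proof.
move=> t; apply: differentiable_continuous; apply/derivable1_diffP.
by have [] := is_derive_flat k t.
Qed.

End flat_functions.

Section smooth_cutoff.
Context {R : realType} {d : nat}.
Local Notation V := 'rV[R]_d.
Local Notation e_ i := (delta_mx ord0 i : V).

(** By the chain rule the partial derivatives of [flat k \o h] lie in the algebra
generated by all the [flat j \o h] and the smooth functions. *)
Lemma rsmooth_flat (k : nat) (h : V -> R) : rsmooth h -> rsmooth (flat k \o h).
Proof.
move=> sh.
have D j i x : derivable (flat j \o h) x (e_ i) /\ 'D_(e_ i) (flat j \o h) x =
    (flat j.+2 (h x) - j%:R * flat j.+1 (h x)) * rpartial i h x.
  have [_ /(_ i x) dh] := rsmooth_C1 sh.
  have /derivable_line dl : derivable h x (e_ i) /\ 'D_(e_ i) h x = rpartial i h x by [].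
  apply/derivable_line.
  have := @is_derive1_comp R (flat j) (fun t : R => h (t *: e_ i + x)) 0 _ _
    (is_derive_flat j _) dl.
  by rewrite scale0r add0r.
pose S := [set g | rsmooth g \/ exists j, g = flat j \o h].
apply: (@alg_smooth _ _ S); last by apply: alg_gen; right; exists k.
move=> g [sg|[j ->]].
  split=> [|i]; first exact: rsmooth_C1.
  by apply: alg_gen; left; exact: rsmooth_partial.
split=> [|i].
  split=> [x|i x]; last by case: (D j i x).
  by apply: continuous_comp; [exact: (rsmooth_C1 sh).1|exact: continuous_flat].
have -> : rpartial i (flat j \o h) =
    (flat j.+2 \o h + cst (- j%:R) * (flat j.+1 \o h)) * rpartial i h.
  apply/funext => x; rewrite /rpartial; case: (D j i x) => _ ->.
  by rewrite -mulNr.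
apply: alg_mul; last by apply: alg_gen; left; exact: rsmooth_partial.
apply: alg_add; first by apply: alg_gen; right; exists j.+2.
by apply: alg_mul; [exact: alg_cst|apply: alg_gen; right; exists j.+1].
Qed.

(** Equal to [1] for [t <= 0], to [0] for [2 <= t], and tangent to [1] to infinite
order at [0].  A composition of two flat functions needs no quotient, contrary to
the usual partition-of-unity formula. *)
Definition cutoff (t : R) : R := expR 1 * flat 0 (1 - 2 * flat 0 t).

Lemma rsmooth_cutoff (h : V -> R) : rsmooth h -> rsmooth (cutoff \o h).
Proof.
move=> sh.
have -> : cutoff \o h =
    cst (expR 1) * (flat 0 \o (cst 1 + cst (- 2) * (flat 0 \o h))).
  by apply/funext => x; rewrite /cutoff /= -mulNr.
apply: rsmoothM; first exact: rsmooth_cst.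
apply: rsmooth_flat; apply: rsmoothD; first exact: rsmooth_cst.
by apply: rsmoothM; [exact: rsmooth_cst|exact: rsmooth_flat].
Qed.
End smooth_cutoff.

Section cutoff_bounds.
Context {R : realType}.
Implicit Types t q : R.

Lemma cutoff_ge0 t : 0 <= cutoff t.
Proof. by rewrite mulr_ge0 ?expR_ge0 ?flat_ge0. Qed.

Lemma cutoff_le1 t : cutoff t <= 1.
Proof.
rewrite /cutoff; set s := 1 - _.
have s1 : s <= 1 by rewrite gerBl mulr_ge0 ?flat_ge0.
have [s0|s0] := leP s 0; first by rewrite flat_le0 // mulr0.
rewrite flat_gt0 // expr0 mul1r -expRD expR_le1 subr_le0.
by rewrite invf_ge1.
Qed.

Lemma cutoff_le0 t : t <= 0 -> cutoff t = 1.
Proof.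
move=> t0; rewrite /cutoff (flat_le0 0 t0) mulr0 subr0 flat_gt0 // expr0 mul1r.
by rewrite invr1 -expRD subrr expR0.
Qed.

(** For [t >= 2] one has [exp (-1/t) >= 1 - 1/t >= 1/2]. *)
Lemma cutoff_ge2 t : 2 <= t -> cutoff t = 0.
Proof.
move=> t2; have t0 : 0 < t by lra.
rewrite /cutoff (@flat_le0 _ 0 (1 - _)) ?mulr0 // flat_gt0 // expr0 mul1r.
have := expR_ge1Dx (- t^-1).
have : t^-1 <= 2^-1 by rewrite lef_pV2 ?posrE.
lra.
Qed.

(** With [v = 2 * flat 0 t < 1/2] the cutoff is [exp (1 - 1/(1 - v))], which is at
least [1 - v/(1 - v)]. *)
Lemma onem_cutoff_le t : 1 - cutoff t <= 4 * flat 0 t.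
Proof.
have f0 := flat_ge0 0 t; have c0 := cutoff_ge0 t.
have [v2|v2] := leP 2^-1 (2 * flat 0 t); first by lra.
rewrite /cutoff; set v := 2 * flat 0 t in v2 *.
have v0 : 0 <= v by rewrite mulr_ge0.
rewrite (@flat_gt0 _ 0 (1 - v)); last by lra.
rewrite expr0 mul1r -expRD.
have := expR_ge1Dx (1 - (1 - v)^-1).
have : (1 - v)^-1 <= 1 + 2 * v.
  by rewrite -[leLHS]div1r ler_pdivrMr; [nra|lra].
have -> : 4 * flat 0 t = 2 * v by rewrite /v; ring.
lra.
Qed.

(** Any power is allowed because the cutoff is infinitely tangent to [1] at [0]. *)
Lemma onem_cutoff_powR q : 0 < q -> exists2 C, 0 <= C &
  forall t, 0 < t -> 1 - cutoff t <= C * t `^ q.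
Proof.
move=> q0; set n := Num.truncn q.
exists (4 * n.+1`!%:R) => [|t t0]; first by rewrite mulr_ge0.
have n1 : 1 <= n.+1`!%:R :> R by rewrite ler1n fact_gt0.
have [t1|t1] := leP t 1.
  apply: le_trans (onem_cutoff_le t) _.
  rewrite -mulrA ler_wpM2l //; apply: le_trans (flat_le 0 n (ltW t0)) _.
  rewrite ler_wpM2l // -powR_mulrn ?(ltW t0) //.
  apply: ger_powR; first by rewrite t0.
  by rewrite ltW // truncnS_gt.
have tq : 1 <= t `^ q by rewrite -(powRr0 t) ler_powR // ltW.
have := cutoff_ge0 t; nra.
Qed.

End cutoff_bounds.

(** * Test functions *)

Section test_functions.
Context {R : realType} {d : nat}.
Local Notation V := 'rV[R]_d.
Local Notation mu := (@lebesgue_rV R d).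
Local Notation e_ i := (delta_mx ord0 i : V).
Local Notation intg f := (mu.-integrable setT (EFin \o f)).
Implicit Types (f g : V -> R).

Definition supported_box (B : R) f := forall x, ~ box B x -> f x = 0.

Definition real_testf f := rsmooth f /\ exists B, supported_box B f.

Lemma box_complement_near B (x : V) : ~ box B x -> \forall y \near x, ~ box B y.
Proof.
move=> xB; apply: open_nbhs_nbhs; split=> //; apply: closed_openC.
exact: compact_closed (@norm_hausdorff _ _) (@box_compact _ _ B).
Qed.

Lemma rpartial_supported B f i : supported_box B f -> supported_box B (rpartial i f).
Proof.
move=> fB x xB; rewrite /rpartial (@near_eq_derive _ _ _ f (cst 0)) ?derive_cst //.
by apply: filterS (box_complement_near xB) => y /fB.
Qed.

Lemma testf_partial f i : real_testf f -> real_testf (rpartial i f).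
Proof.
move=> [sf [B fB]]; split; first exact: rsmooth_partial.
by exists B; exact: rpartial_supported.
Qed.

Lemma testfM g f : rsmooth g -> real_testf f -> real_testf (g * f).
Proof.
move=> sg [sf [B fB]]; split; first exact: rsmoothM.
by exists B => x /fB fx; rewrite fctE fx mulr0.
Qed.

Lemma testf_continuous f : real_testf f -> continuous f.
Proof. by move=> [/rsmooth_C1[]]. Qed.

Lemma testf_measurable f : real_testf f -> measurable_fun setT f.
Proof. by move=> /testf_continuous; exact: continuous_measurable_rV. Qed.

Lemma supported_box_bounded B f : continuous f -> supported_box B f ->
  exists2 M, 0 <= M & forall x, `|f x| <= M.
Proof.
move=> cf fB.
have : bounded_set (f @` box B).
  apply: compact_bounded; apply: continuous_compact; last exact: box_compact.
  exact: continuous_subspaceT.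
move=> [M [_ fM]]; exists (`|M| + 1) => [|x]; first by rewrite addr_ge0.
have [xB|/fB ->] := pselect (box B x); last by rewrite normr0 addr_ge0.
apply: fM; last by exists x.
by rewrite (le_lt_trans (ler_norm M)) // ltrDl.
Qed.

Lemma testf_bounded f : real_testf f -> exists2 M, 0 <= M & forall x, `|f x| <= M.
Proof.
by move=> tf; have [_ [B fB]] := tf; apply: supported_box_bounded (testf_continuous tf) fB.
Qed.

Lemma integrable_indic_box B : intg (\1_(box B) : V -> R).
Proof.
apply/integrableP; split.
  by apply/measurable_EFinP; apply: measurable_indic; exact: box_measurable.
under eq_integral do rewrite /= ger0_norm //.
rewrite integral_indic ?setIT //; first exact: box_finite.
exact: box_measurable.
Qed.

Lemma bounded_supported_integrable f B M : measurable_fun setT f ->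
  (forall x, `|f x| <= M) -> supported_box B f -> intg f.
Proof.
move=> mf fM fB; apply: (@integrable_le _ _ _ _ _ (fun x => M * \1_(box B) x)) => //.
- move=> x; have [xB|xB] := pselect (box B x).
    by rewrite indicE mem_set // mulr1.
  by rewrite fB // normr0 mulr_ge0 // (le_trans _ (fM x)).
- exact: (integrableZl measurableT M (integrable_indic_box B)).
Qed.

Lemma testf_integrable f : real_testf f -> intg f.
Proof.
move=> tf; have [M _ fM] := testf_bounded tf; have [_ [B fB]] := tf.
exact: bounded_supported_integrable (testf_measurable tf) fM fB.
Qed.

End test_functions.

(** * Oscillatory integrals *)

Section oscillatory_integrals.
Context {R : realType} {d : nat}.
Local Notation V := 'rV[R]_d.
Local Notation mu := (@lebesgue_rV R d).
Local Notation e_ i := (delta_mx ord0 i : V).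
Local Notation intg f := (mu.-integrable setT (EFin \o f)).
Implicit Types (f g k phi : V -> R).

Lemma measurable_cos_comp d1 (T : measurableType d1) (f : T -> R) :
  measurable_fun setT f -> measurable_fun setT (fun x => cos (f x)).
Proof.
move=> mf; apply: (measurableT_comp _ mf); apply: continuous_measurable_fun.
exact: continuous_cos.
Qed.

Lemma normr_cos_le1 (x : R) : `|cos x| <= 1.
Proof. by rewrite ler_norml cos_geN1 cos_le1. Qed.

Lemma integrable_mul_cos f phi : measurable_fun setT phi -> intg f ->
  intg (fun y => f y * cos (phi y)).
Proof.
move=> mphi fi; apply: (@integrable_mul_bounded _ _ _ _ _ _ 1) => // [|x].
  exact: measurable_cos_comp.
exact: normr_cos_le1.
Qed.

Lemma cos_lipschitz (a b : R) : `|cos a - cos b| <= `|a - b|.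
Proof.
wlog ab : a b / a < b.
  move=> H; have [/H//|/H|->] := ltgtP a b; last by rewrite !subrr.
  by rewrite distrC (distrC b).
have [c _ E] := @MVT R cos (fun x => - sin x) a b ab
  (fun x _ => is_derive_cos x) (continuous_subspaceT (@continuous_cos R)).
rewrite distrC E normrM (distrC a) ler_piMl // normrN.
by rewrite ler_norml sin_geN1 sin_le1.
Qed.

(** Differentiation under the integral sign; the derivative of the cosine is a shift
of its phase by [pi / 2]. *)
Lemma is_derive_cos_integral f phi k :
  measurable_fun setT phi -> measurable_fun setT k -> intg f ->
  intg (fun y => f y * k y) ->
  is_derive (0 : R) 1 (fun t : R => \int[mu]_y (f y * cos (phi y + t * k y)))
    (\int[mu]_y (f y * k y * cos (phi y + pi / 2))).
Proof.
move=> mphi mk fi fki.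
pose F t y := f y * cos (phi y + t * k y).
have dF (t : R) (y : V) : is_derive t (1 : R) (fun u : R => F u y) (f y * k y * cos (phi y + t * k y + pi / 2)).
  have d1 : is_derive t 1 (fun u : R => phi y + u * k y) (k y).
    by apply: is_derive_eq; rewrite /GRing.scale /=; ring.
  have d2 := @is_derive1_comp R cos (fun u => phi y + u * k y) t _ _ (is_derive_cos _) d1.
  have := is_deriveM (is_derive_cst (f y) t 1) d2.
  rewrite /GRing.scale /= => H; apply: (is_derive_eq (f := fun u : R => F u y) H).
  by rewrite cosDpihalf; ring.
have iF t : intg (F t).
  apply: integrable_mul_cos fi; apply: measurable_funD => //.
  exact: measurable_funM.
have z01 : [set` `](-1 : R), 1[] (0 : R) by rewrite /= in_itv /= ltrN10 ltr01.
have derF t y : [set` `](-1 : R), 1[] t -> setT y -> derivable (F ^~ y) t 1.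
  by move=> _ _; case: (dF t y).
have ub t y : [set` `](-1 : R), 1[] t -> setT y -> `|partial1of2 F t y| <= `|f y * k y|.
  move=> _ _; rewrite partial1of2E; case: (dF t y) => _ ->.
  by rewrite normrM ler_piMr // normr_cos_le1.
have ig := integrable_normr fki.
have D := @derivable_under_integral R _ _ mu F setT measurableT 0 (-1) 1 z01
  (fun x _ => iF x) derF _ (fun y => normr_ge0 _) ig ub.
apply: DeriveDef => //; rewrite -derive1E.
rewrite (@differentiation_under_integral R _ _ mu F setT measurableT 0 (-1) 1 z01
  (fun x _ => iF x) derF _ (fun y => normr_ge0 _) ig ub).
apply: eq_Rintegral => y _; rewrite partial1of2E; case: (dF 0 y) => _ ->.
by rewrite mul0r addr0.
Qed.

(** The cosine transform with phase [th].  The phases [0] and [pi / 2] give the real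
part and minus the imaginary part of the integral of [f y * e^{i y.xi}]. *)
Definition osc f (th : R) (xi : V) : R := \int[mu]_y (f y * cos (dotv y xi + th)).

Lemma measurable_dotvl (xi : V) : measurable_fun setT (fun y : V => dotv y xi).
Proof. exact: measurable_dotv. Qed.

Lemma osc_integrable f th xi : intg f -> intg (fun y => f y * cos (dotv y xi + th)).
Proof.
by move=> fi; apply: integrable_mul_cos fi; apply: measurable_funD => //; exact: measurable_dotvl.
Qed.

Lemma osc_le f th xi : intg f -> `|osc f th xi| <= \int[mu]_y `|f y|.
Proof.
move=> fi; apply: le_trans (le_normr_Rintegral measurableT (osc_integrable th xi fi)) _.
apply: le_Rintegral => //.
- exact: integrable_normr (osc_integrable th xi fi).
- exact: integrable_normr fi.
- by move=> y _; rewrite normrM ler_piMr // normr_cos_le1.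
Qed.

(** A derivative in [xi] multiplies [f] by a coordinate and shifts the phase. *)
Lemma osc_derive f th i xi : real_testf f ->
  derivable (osc f th) xi (e_ i) /\
  rpartial i (osc f th) xi = osc ((fun y : V => y ord0 i) * f) (th + pi / 2) xi.
Proof.
move=> tf; apply/derivable_line.
have -> : (fun t : R => osc f th (t *: e_ i + xi)) = (fun t : R => \int[mu]_y
    (f y * cos ((dotv y xi + th) + t * y ord0 i))).
  apply/funext => t; apply: eq_Rintegral => y _; congr (_ * cos _).
  by rewrite dotvDr dotvZr dotv_delta; ring.
have -> : osc ((fun y : V => y ord0 i) * f) (th + pi / 2) xi =
    \int[mu]_y (f y * y ord0 i * cos (dotv y xi + th + pi / 2)).
  by apply: eq_Rintegral => y _; rewrite fctE (mulrC (f y)) addrA.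
apply: is_derive_cos_integral.
- by apply: measurable_funD => //; exact: measurable_dotvl.
- exact: measurable_coord.
- exact: testf_integrable.
- have := testf_integrable (testfM (rsmooth_coord i) tf).
  by congr (_.-integrable _ _); apply/funext => y /=; rewrite mulrC.
Qed.

Lemma dotv_norm (x y : V) : `|dotv x y| <= (\sum_(i < d) `|x ord0 i|) * `|y|.
Proof.
rewrite /dotv mulr_suml; apply: le_trans (ler_norm_sum _ _ _) _.
apply: ler_sum => i _; rewrite normrM ler_wpM2l //.
rewrite [leRHS]/Num.norm /= mx_normrE; apply/bigmax_geP; right => /=.
by exists (ord0, i).
Qed.

(** The transform is Lipschitz, since the cosine is and [f] has bounded support. *)
Lemma osc_continuous f th : real_testf f -> continuous (osc f th).
Proof.
move=> tf; have fi := testf_integrable tf; have [_ [B fB]] := tf.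
(* On the box |y.eta| <= d B |eta|; the added 1 keeps K positive. *)
pose K := d%:R * `|B| * (\int[mu]_y `|f y|) + 1.
have I0 : 0 <= \int[mu]_y `|f y| by apply: Rintegral_ge0.
have K0 : 0 < K by rewrite ltr_wpDl // !mulr_ge0.
have lip x y : `|osc f th x - osc f th y| <= K * `|x - y|.
  rewrite -RintegralB //; [|exact: osc_integrable..].
  have ii : intg (fun z => f z * cos (dotv z x + th) - f z * cos (dotv z y + th)).
    exact: (integrableB measurableT (osc_integrable th x fi) (osc_integrable th y fi)).
  apply: le_trans (le_normr_Rintegral measurableT ii) _.
  apply: (@le_trans _ _ (\int[mu]_z (d%:R * `|B| * `|x - y| * `|f z|))); last first.
    rewrite RintegralZl //; last exact: integrable_normr.
    by rewrite /K; have := normr_ge0 (x - y); nra.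
  apply: le_Rintegral => //; first exact: integrable_normr ii.
    exact: (integrableZl measurableT _ (integrable_normr fi)).
  move=> z _; rewrite -mulrBr normrM.
  have [zB|/fB ->] := pselect (box B z); last by rewrite normr0 mulr0 mul0r.
  rewrite mulrC ler_wpM2r //; apply: le_trans (cos_lipschitz _ _) _.
  rewrite opprD addrACA subrr addr0 -mulN1r -dotvZr -dotvDr scaleN1r.
  apply: le_trans (dotv_norm _ _) _; rewrite ler_wpM2r //.
  have -> : d%:R * `|B| = \sum_(i < d) `|B|.
    by rewrite sumr_const card_ord mulr_natl.
  apply: ler_sum => i _; have := zB i; rewrite in_itv /= -ler_norml => /le_trans; apply.
  exact: ler_norm.
move=> x A /= /(nbhs_ballP (osc f th x))[eps eps0 epsA].
apply/nbhs_ballP; exists (eps / K) => [|y]; first exact: divr_gt0.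
rewrite -ball_normE /= => xy.
apply: epsA; apply: le_lt_trans (lip x y) _.
by rewrite -ltr_pdivlMl // mulrC.
Qed.

End oscillatory_integrals.

(** * Decay of oscillatory integrals *)

Section fourier_decay.
Context {R : realType} {d : nat}.
Local Notation V := 'rV[R]_d.
Local Notation mu := (@lebesgue_rV R d).
Local Notation e_ i := (delta_mx ord0 i : V).
Local Notation intg f := (mu.-integrable setT (EFin \o f)).
Implicit Types (f g : V -> R).

(** Differentiation under the integral sign for a translated test function: for
[|t| < 1] all the translates live in one larger box. *)
Lemma is_derive_shifted_integral f phi i : real_testf f -> measurable_fun setT phi ->
  is_derive (0 : R) 1 (fun t : R => \int[mu]_y (f (t *: e_ i + y) * cos (phi y)))
    (\int[mu]_y (rpartial i f y * cos (phi y))).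
Proof.
move=> tf mphi.
have tf' := testf_partial i tf; have [M M0 fM] := testf_bounded tf'.
have [_ [B fB]] := tf; have fB' := rpartial_supported i fB.
pose F (t : R) (y : V) : R := f (t *: e_ i + y) * cos (phi y).
pose G (y : V) : R := M * \1_(box (B + 1)) y.
have dF (t : R) (y : V) : is_derive t (1 : R) (fun u : R => F u y)
    (rpartial i f (t *: e_ i + y) * cos (phi y)).
  have df : derivable f (t *: e_ i + y) (e_ i) by exact: (rsmooth_C1 tf.1).2.
  have := is_deriveM (derivable_shift_line df) (is_derive_cst (cos (phi y)) t 1).
  rewrite /GRing.scale /= => H; apply: (is_derive_eq (f := fun u : R => F u y) H).
  by rewrite mulr0 add0r mulrC.
have iF t : intg (F t).
  apply: integrable_mul_cos => //.
  have := integrable_affine (t *: e_ i) (oner_neq0 R) (testf_integrable tf).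
  by congr (_.-integrable _ _); apply/funext => y /=; rewrite scale1r.
have z01 : [set` `](-1 : R), 1[] (0 : R) by rewrite /= in_itv /= ltrN10 ltr01.
have derF t y : [set` `](-1 : R), 1[] t -> setT y -> derivable (F ^~ y) t 1.
  by move=> _ _; case: (dF t y).
have ub t y : [set` `](-1 : R), 1[] t -> setT y ->
    `|partial1of2 F t y| <= G y.
  rewrite /G /= in_itv /= => /andP[t1 t2] _; rewrite partial1of2E; case: (dF t y) => _ ->.
  have [yB|yB] := pselect (box (B + 1) y).
    by rewrite indicE mem_set // mulr1 normrM (le_trans _ (fM (t *: e_ i + y))) // ler_piMr // normr_cos_le1.
  rewrite fB' ?mul0r ?normr0 ?mulr_ge0 // => H; apply: yB => j.
  have := H j; rewrite !mxE !in_itv /=.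
  case: (j == i) => /=; rewrite ?mulr1 ?mulr0 ?add0r; move=> /andP[h1 h2]; apply/andP; split; lra.
have G0 y : 0 <= G y by rewrite mulr_ge0.
have ig : intg G.
  exact: (integrableZl measurableT M (integrable_indic_box (B + 1))).
have D := @derivable_under_integral R _ _ mu F setT measurableT 0 (-1) 1 z01
  (fun x _ => iF x) derF G G0 ig ub.
apply: DeriveDef => //; rewrite -derive1E.
rewrite (@differentiation_under_integral R _ _ mu F setT measurableT 0 (-1) 1 z01
  (fun x _ => iF x) derF G G0 ig ub).
apply: eq_Rintegral => y _; rewrite partial1of2E; case: (dF 0 y) => _ ->.
by rewrite scale0r add0r.
Qed.

(** Integration by parts.  A translation of [f] can be moved onto the phase by the
invariance of Lebesgue measure; the two derivatives at [0] are the two sides. *)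
Lemma osc_partial f i th (xi : V) : real_testf f ->
  xi ord0 i * osc f th xi = osc (rpartial i f) (th + pi / 2) xi.
Proof.
move=> tf; have fi := testf_integrable tf.
set th' := th + pi / 2.
have mphi c : measurable_fun setT (fun y : V => dotv y xi + c).
  by apply: measurable_funD => //; exact: measurable_dotvl.
have [_ D1] := is_derive_shifted_integral i tf (mphi th').
have [_ D2] : is_derive (0 : R) 1
    (fun t : R => \int[mu]_y (f (t *: e_ i + y) * cos (dotv y xi + th')))
    (\int[mu]_y (f y * - xi ord0 i * cos (dotv y xi + th' + pi / 2))).
  have -> : (fun t : R => \int[mu]_y (f (t *: e_ i + y) * cos (dotv y xi + th'))) =
      (fun t : R => \int[mu]_y (f y * cos (dotv y xi + th' + t * - xi ord0 i))).
    apply/funext => t.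
    rewrite -[in RHS](Rintegral_translate (t *: e_ i)); last first.
      by apply: integrable_mul_cos => //; apply: measurable_funD => //; exact: mphi.
    apply: eq_Rintegral => y _; congr (_ * cos _).
    by rewrite dotvDl dotvZl (dotvC (e_ i)) dotv_delta; ring.
  apply: is_derive_cos_integral => //.
  have := integrableZl measurableT (- xi ord0 i) fi.
  by congr (_.-integrable _ _); apply/funext => y /=; rewrite -EFinM mulrC.
rewrite -[RHS]D1 D2 /osc -RintegralZl //; last exact: osc_integrable.
apply: eq_Rintegral => y _.
by rewrite addrA cosDpihalf sinDpihalf; ring.
Qed.

Definition rdecay f := forall N, exists C, forall x, (1 + dotv x x) ^+ N * `|f x| <= C.

Lemma bracket_ge1 (x : V) : 1 <= 1 + dotv x x.
Proof. by rewrite lerDl dotv_ge0. Qed.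

Lemma bracket_ge0 (x : V) : 0 <= 1 + dotv x x.
Proof. exact: le_trans (bracket_ge1 x). Qed.

(** A factor [1 + |xi|^2] is absorbed by replacing [f] by itself and by its second
derivatives, thanks to [osc_partial]. *)
Lemma osc_decay f th : real_testf f -> rdecay (osc f th).
Proof.
move=> tf N; elim: N f th tf => [|N IH] f th tf.
  exists (\int[mu]_y `|f y|) => x; rewrite mul1r.
  exact: osc_le (testf_integrable tf).
have [C0 C0P] := IH f th tf.
have /choice[C CP] i := IH _ (th + pi / 2 + pi / 2) (testf_partial i (testf_partial i tf)).
exists (C0 + \sum_(i < d) C i) => x; rewrite exprSr -mulrA.
(* Two integrations by parts in each direction. *)
have -> : (1 + dotv x x) * `|osc f th x| = `|osc f th x| + \sum_(i < d)
    `|osc (rpartial i (rpartial i f)) (th + pi / 2 + pi / 2) x|.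
  rewrite mulrDl mul1r /dotv mulr_suml; congr (_ + _); apply: eq_bigr => i _.
  rewrite -osc_partial; last exact: testf_partial.
  by rewrite -osc_partial // mulrA normrM ger0_norm // -expr2 sqr_ge0.
rewrite mulrDr mulr_sumr lerD //.
by apply: ler_sum => i _; exact: CP.
Qed.

(** The power [(1 + |x|^2) ^ d] dominates the product of the [1 + x_i^2]. *)
Lemma rdecay_integrable f : measurable_fun setT f -> rdecay f -> intg f.
Proof.
move=> mf /(_ d) [C fC].
have w0 (x : V) i : 0 <= (1 + x ord0 i ^+ 2)^-1 by rewrite invr_ge0 addr_ge0 ?sqr_ge0.
have p0 (x : V) : 0 <= \prod_(i < d) (1 + x ord0 i ^+ 2)^-1 by apply: prodr_ge0.
have mp : measurable_fun setT (fun x : V => \prod_(i < d) (1 + x ord0 i ^+ 2)^-1).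
  apply: measurable_prod => i _.
  apply: (measurableT_comp (f := fun a : R => (1 + a ^+ 2)^-1)).
    by apply: continuous_measurable_fun; exact: continuous_oneDsqrV.
  exact: measurable_coord.
apply: (@integrable_le _ _ _ _ _ (fun x : V => C * \prod_(i < d) (1 + x ord0 i ^+ 2)^-1)) => //.
  move=> x; have := fC x.
  have : \prod_(i < d) (1 + x ord0 i ^+ 2) <= (1 + dotv x x) ^+ d.
    rewrite -[X in _ ^+ X]card_ord -prodr_const; apply: ler_prod => i _.
    rewrite addr_ge0 ?sqr_ge0 //= lerD2l /dotv (bigD1 i) //= -expr2 lerDl.
    by apply: sumr_ge0 => j _; rewrite -expr2 sqr_ge0.
  rewrite prodfV ler_pdivlMr; last first.
    by apply: prodr_gt0 => i _; rewrite ltr_pwDl ?sqr_ge0.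
  by move=> h1 h2; apply: le_trans h2; rewrite mulrC ler_wpM2r.
have ip : intg (fun x : V => \prod_(i < d) (1 + x ord0 i ^+ 2)^-1).
  apply/integrableP; split; first exact/measurable_EFinP.
  apply: le_lt_trans (@integral_prod_oneDsqrV R d).
  by apply: ge0_le_integral => //=; [apply/measurable_EFinP/measurableT_comp|
    exact/measurable_EFinP|move=> x _; rewrite lee_fin ger0_norm].
exact: (integrableZl measurableT C ip).
Qed.

Lemma osc_intg f th : real_testf f -> intg (osc f th).
Proof.
move=> tf; apply: rdecay_integrable; last exact: osc_decay.
by apply: continuous_measurable_rV; exact: osc_continuous.
Qed.

End fourier_decay.

Local Notation normc := ComplexField.Normc.normc.

(** * Membership in the Schwartz space *)

Section schwartz_criterion.
Context {R : realType} {d : nat}.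
Local Notation V := 'rV[R]_d.
Local Open Scope complex_scope.

Lemma normc_ge0 (z : R[i]) : 0 <= normc z.
Proof. by case: z => a b; exact: sqrtr_ge0. Qed.

Lemma normc_le (z : R[i]) : normc z <= `|complex.Re z| + `|complex.Im z|.
Proof.
case: z => a b /=; rewrite -[leRHS]ger0_norm ?addr_ge0 // -sqrtr_sqr ler_wsqrtr //.
by rewrite sqrrD !real_normK ?num_real // -addrA lerD2l lerDr mulrn_wge0 // mulr_ge0.
Qed.

Lemma normr_Re_le (z : R[i]) : `|complex.Re z| <= normc z.
Proof. by case: z => a b /=; rewrite -sqrtr_sqr ler_wsqrtr // lerDl sqr_ge0. Qed.

Lemma normr_Im_le (z : R[i]) : `|complex.Im z| <= normc z.
Proof. by case: z => a b /=; rewrite -sqrtr_sqr ler_wsqrtr // lerDr sqr_ge0. Qed.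

Lemma reF_partials s (f : V -> R[i]) : reF (partials s f) = rpartials s (reF f).
Proof. by elim: s => //= i s <-. Qed.

Lemma imF_partials s (f : V -> R[i]) : imF (partials s f) = rpartials s (imF f).
Proof. by elim: s => //= i s <-. Qed.

(** The elements of such a set are real Schwartz functions; their smoothness follows by
coinduction. *)
Definition decay_stable (S : set (V -> R)) := forall g, S g ->
  [/\ C1 g, forall i, S (rpartial i g) & rdecay g].

(** The Schwartz seminorms take a supremum over all the lists of at most [N]
directions; there are finitely many of them, and the induction adds up the
bounds over the innermost direction. *)
Lemma decay_stable_uniform S : decay_stable S -> forall g, S g -> forall k N,
  exists C, forall s x, (size s <= k)%N ->
    (1 + dotv x x) ^+ N * `|rpartials s g x| <= C.
Proof.
move=> SP g Sg k N; elim: k g Sg => [|k IH] g Sg; have [_ pS /(_ N) [C0 C0P]] := SP g Sg.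
  by exists C0 => s x; rewrite leqn0 size_eq0 => /eqP ->; exact: C0P.
have /choice[C CP] i := IH _ (pS i).
have C_ge0 i : 0 <= C i.
  apply: le_trans (CP i [::] 0 isT); rewrite mulr_ge0 // exprn_ge0 //.
  exact: bracket_ge0.
have C0_ge0 : 0 <= C0.
  apply: le_trans (C0P 0); rewrite mulr_ge0 // exprn_ge0 //.
  exact: bracket_ge0.
exists (C0 + \sum_(i < d) C i) => s x; case/lastP: s => [|s i] sk.
  by rewrite (le_trans (C0P x)) // lerDl sumr_ge0.
rewrite rpartials_rcons; rewrite size_rcons ltnS in sk.
rewrite (le_trans (CP i s x sk)) // (bigD1 i) //= addrCA lerDl addr_ge0 //.
exact: sumr_ge0.
Qed.

Lemma decay_stable_smooth S g : decay_stable S -> S g -> rsmooth g.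
Proof. by move=> SP; apply: rsmooth_coind => h /SP[]. Qed.

Lemma schwartz_criterion S (f : V -> R[i]) :
  decay_stable S -> S (reF f) -> S (imF f) -> f \in schwartz_pred.
Proof.
move=> SP Sr Si; apply/asboolP; split=> [s|N].
  rewrite reF_partials imF_partials.
  have [cr dr] := decay_stable_smooth SP Sr s.
  have [ci di] := decay_stable_smooth SP Si s.
  by split.
have [C1 C1P] := decay_stable_uniform SP Sr N N.
have [C2 C2P] := decay_stable_uniform SP Si N N.
apply: (@le_lt_trans _ _ (C1 + C2)%:E); last by rewrite ltry.
apply: ub_ereal_sup => _ [x _ [s sN <-]]; rewrite lee_fin.
apply: le_trans (_ : (1 + dotv x x) ^+ N *
   (`|rpartials s (reF f) x| + `|rpartials s (imF f) x|) <= _).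
  rewrite ler_wpM2l ?exprn_ge0 ?bracket_ge0 //.
  by rewrite -reF_partials -imF_partials; exact: normc_le.
by rewrite mulrDr lerD //; [exact: C1P|exact: C2P].
Qed.

Lemma testf_decay_stable : decay_stable (@real_testf R d).
Proof.
move=> g tg; split; [exact: rsmooth_C1 tg.1|by move=> i; exact: testf_partial|].
move=> N; have [sg [B gB]] := tg.
pose h x := (1 + dotv x x) ^+ N * g x.
have ch : continuous h.
  apply: (rsmooth_C1 _).1; apply: (rsmoothM _ sg).
  elim: N {h} => [|N IH]; first exact: (rsmooth_cst 1).
  rewrite (_ : (fun _ => _) = (cst 1 + (fun x => dotv x x)) *
    (fun x => (1 + dotv x x) ^+ N)); last by apply/funext => x; rewrite exprS.
  exact: (rsmoothM (rsmoothD (rsmooth_cst 1) rsmooth_dotv) IH).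
have hB : supported_box B h by move=> x xB; rewrite /h gB // mulr0.
have [M _ hM] := supported_box_bounded ch hB.
exists M => x; apply: le_trans (hM x).
by rewrite /h normrM (ger0_norm (exprn_ge0 _ (bracket_ge0 _))).
Qed.

(** Two terms suffice for the real and the imaginary part of a Fourier transform of a
complex function. *)
Definition osc_pair : set (V -> R) :=
  [set h | exists f g a b th ta, [/\ real_testf f, real_testf g &
    h = (fun x => a * osc f th x + b * osc g ta x)]].

Lemma osc_pair_decay_stable : decay_stable osc_pair.
Proof.
move=> _ [f [g [a [b [th [ta [tf tg ->]]]]]]].
have Cf : C1 (osc f th).
  by split; [exact: osc_continuous|move=> i x; case: (osc_derive th i x tf)].
have Cg : C1 (osc g ta).
  by split; [exact: osc_continuous|move=> i x; case: (osc_derive ta i x tg)].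
have Caf := C1M (C1_cst a) Cf; have Cbg := C1M (C1_cst b) Cg.
split.
- exact: (C1D Caf Cbg).
- move=> i; exists ((fun y : V => y ord0 i) * f), ((fun y : V => y ord0 i) * g), a, b,
    (th + pi / 2), (ta + pi / 2).
  split; [exact: testfM (rsmooth_coord i) tf|exact: testfM (rsmooth_coord i) tg|].
  rewrite -[fun x => _ in LHS]/(cst a * osc f th + cst b * osc g ta).
  rewrite (rpartialD i Caf Cbg) (rpartialM i (C1_cst a) Cf) (rpartialM i (C1_cst b) Cg).
  apply/funext => x; rewrite (rpartial_cst i a) (rpartial_cst i b) !fctE !mulr0 !addr0.
  by have [_ ->] := osc_derive th i x tf; have [_ ->] := osc_derive ta i x tg.
- move=> N; have [A AP] := osc_decay th tf N; have [B BP] := osc_decay ta tg N.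
  exists (`|a| * A + `|b| * B) => x.
  have w0 := exprn_ge0 N (bracket_ge0 x).
  apply: (@le_trans _ _ ((1 + dotv x x) ^+ N * (`|a| * `|osc f th x| + `|b| * `|osc g ta x|))).
    by rewrite ler_wpM2l // -!normrM ler_normD.
  by rewrite mulrDr !(mulrCA _ `|_|) lerD // ler_wpM2l.
Qed.

End schwartz_criterion.

(** * Fourier inversion for real test functions *)

Section fourier_inversion.
Context {R : realType} {d : nat}.
Local Notation V := 'rV[R]_d.
Local Notation mu := (@lebesgue_rV R d).
Local Notation intg f := (mu.-integrable setT (EFin \o f)).
Implicit Types (f g h : V -> R) (x z xi : V).

Lemma notin_box B x : 0 <= B -> ~ box B x -> B ^+ 2 < dotv x x.
Proof.
move=> B0 xB; have [i xi] : exists i, x ord0 i \notin `[- B, B].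
  apply: contrapT => H; apply: xB => i; apply: contrapT => /negP xi.
  by apply: H; exists i.
rewrite in_itv /= -ler_norml -ltNge in xi.
rewrite /dotv (bigD1 i) //= -expr2 -[x ord0 i ^+ 2]real_normK ?num_real //.
apply: (@lt_le_trans _ _ (`|x ord0 i| ^+ 2)); first by rewrite ltr_pXn2r // nnegrE.
by rewrite lerDl sumr_ge0 // => j _; rewrite -expr2 sqr_ge0.
Qed.

Lemma testf_cutoff (q : V -> R) B : rsmooth q -> 0 <= B ->
  (forall x, q x < 2 -> dotv x x <= B ^+ 2) -> real_testf (cutoff \o q).
Proof.
move=> sq B0 qB; split; first exact: rsmooth_cutoff.
exists B => x /(notin_box B0) xB /=; apply: cutoff_ge2.
by rewrite leNgt; apply/negP => /qB; rewrite leNgt xB.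
Qed.

(** Near [0] the function is at least [h 0 / 2], on a box of positive volume. *)
Lemma Rintegral_gt0 h : continuous h -> (forall x, 0 <= h x) -> intg h ->
  0 < h 0 -> 0 < \int[mu]_x h x.
Proof.
move=> ch h0 ih hp.
have /cvgrPdist_lt /(_ (h 0 / 2)) := ch 0.
rewrite divr_gt0 // => /(_ isT) /nbhs_ballP[e /= e0 eh].
have hb x : box (e / 2) x -> h 0 / 2 <= h x.
  move=> xe; have /eh /= : ball (0 : V) e x.
    split=> // i j; rewrite (ord1 i) /ball /= !mxE sub0r normrN.
    have := xe j; rewrite in_itv /= -ler_norml => /le_lt_trans; apply.
    by rewrite ltr_pdivrMr // mulr2n mulrDr mulr1 ltrDl.
  rewrite ltr_norml => /andP[_]; lra.
have ii := integrableZl measurableT (h 0 / 2) (integrable_indic_box (d := d) (e / 2)).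
apply: (@lt_le_trans _ _ (\int[mu]_x (h 0 / 2 * \1_(box (e / 2)) x))); last first.
  apply: le_Rintegral => // x _; have [xe|xe] := pselect (box (e / 2) x).
    by rewrite indicE mem_set // mulr1; exact: hb.
  by rewrite indicE memNset // mulr0.
rewrite RintegralZl //; last exact: integrable_indic_box.
rewrite mulr_gt0 ?divr_gt0 // /Rintegral integral_indic ?setIT //; last exact: box_measurable.
have e2 : 0 <= e / 2 by rewrite divr_ge0 ?ltW.
have := congr1 fine (@lebesgue_box R d _ e2) => /= ->.
by rewrite exprn_gt0 // pmulrn_lgt0 // divr_gt0.
Qed.

Lemma osc_shift f a b xi : intg f ->
  osc f (a + b) xi = cos b * osc f a xi + sin b * osc f (a + pi / 2) xi.
Proof.
move=> fi; rewrite /osc -!RintegralZl //; [|exact: osc_integrable..].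
rewrite -RintegralD //; last 2 first.
- exact: (integrableZl measurableT _ (osc_integrable _ _ fi)).
- exact: (integrableZl measurableT _ (osc_integrable _ _ fi)).
apply: eq_Rintegral => y _.
by rewrite !addrA cosDpihalf [cos (_ + b)]cosD; ring.
Qed.

(** The cutoff that regularizes the inversion integral. *)
Definition chi x : R := cutoff (dotv x x).

Lemma testf_chi : real_testf chi.
Proof.
apply: (@testf_cutoff (fun x => dotv x x) 2) => // [|x]; first exact: rsmooth_dotv.
lra.
Qed.

Lemma chi_ge0 x : 0 <= chi x. Proof. exact: cutoff_ge0. Qed.

Lemma normr_chi_le1 x : `|chi x| <= 1.
Proof. by rewrite ger0_norm ?chi_ge0 // cutoff_le1. Qed.

Lemma chi0 : chi 0 = 1.
Proof.
by rewrite /chi cutoff_le0 // /dotv big1 // => i _; rewrite mxE mul0r.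
Qed.

Let chii : intg chi := testf_integrable testf_chi.

(** The function [chi] is even, so its sine transform vanishes. *)
Lemma osc_chi_pihalf xi : osc chi (pi / 2) xi = 0.
Proof.
have : osc chi (pi / 2) xi = - osc chi (pi / 2) xi; last by lra.
rewrite {1}/osc -Rintegral_reflect; last exact: osc_integrable.
rewrite -mulN1r /osc -RintegralZl //; last exact: osc_integrable.
apply: eq_Rintegral => y _; rewrite /chi !dotvNl (dotvC y (- y)) dotvNl opprK.
by rewrite !cosDpihalf sinN; ring.
Qed.

Lemma osc_chi th xi : osc chi th xi = cos th * osc chi 0 xi.
Proof.
by rewrite -[in LHS](add0r th) osc_shift // add0r osc_chi_pihalf mulr0 addr0.
Qed.

(** Its value is [(2 * pi) ^+ d]. *)
Definition inversion_constant : R := \int[mu]_xi osc chi 0 xi.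

(** The integrand of the inversion formula: the integral over [y] of
[f y * cos ((y - x).xi + th)]. *)
Definition modosc f x th xi : R := osc f (th - dotv x xi) xi.

Lemma modoscE f x th xi : intg f -> modosc f x th xi =
  cos (th - dotv x xi) * osc f 0 xi + sin (th - dotv x xi) * osc f (pi / 2) xi.
Proof. by move=> fi; rewrite /modosc -[X in osc _ X]add0r osc_shift // add0r. Qed.

Lemma normr_sin_le1 (t : R) : `|sin t| <= 1.
Proof. by rewrite ler_norml sin_geN1 sin_le1. Qed.

Lemma modosc_le f x th xi : intg f ->
  `|modosc f x th xi| <= `|osc f 0 xi| + `|osc f (pi / 2) xi|.
Proof.
move=> fi; rewrite modoscE //; apply: le_trans (ler_normD _ _) _.
by rewrite !normrM lerD // ler_piMl // ?normr_cos_le1 ?normr_sin_le1.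
Qed.

Lemma measurable_sin_comp d1 (T : measurableType d1) (k : T -> R) :
  measurable_fun setT k -> measurable_fun setT (fun t => sin (k t)).
Proof.
move=> mf; apply: (measurableT_comp _ mf); apply: continuous_measurable_fun.
exact: continuous_sin.
Qed.

Lemma modosc_measurable f x th : real_testf f -> measurable_fun setT (modosc f x th).
Proof.
move=> tf; have fi := testf_integrable tf.
rewrite (_ : modosc f x th = (fun xi => cos (th - dotv x xi) * osc f 0 xi +
    sin (th - dotv x xi) * osc f (pi / 2) xi)); last first.
  by apply/funext => xi; rewrite modoscE.
have mp : measurable_fun setT (fun xi => th - dotv x xi).
  by apply: measurable_funB => //; exact: measurable_dotv.
by apply: measurable_funD; apply: measurable_funM;
  [exact: measurable_cos_comp|exact: integrable_measurable (osc_intg _ tf)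
  |exact: measurable_sin_comp|exact: integrable_measurable (osc_intg _ tf)].
Qed.

Lemma osc_sum_integrable f : real_testf f ->
  intg (fun xi => `|osc f 0 xi| + `|osc f (pi / 2) xi|).
Proof.
move=> tf; exact: (integrableD measurableT (integrable_normr (osc_intg 0 tf))
  (integrable_normr (osc_intg (pi / 2) tf))).
Qed.

Lemma measurable_dilation (e : R) : measurable_fun setT (fun x => e *: x).
Proof. by have := measurable_affine (0 : V) e; under eq_fun do rewrite add0r. Qed.

(** Fubini for [f (x + e z) * chi xi * cos (z.xi + th)], followed by the changes of
variables [y = x + e z] and [xi -> e xi], whose Jacobians cancel. *)
Lemma inversion_regularized f x th e : real_testf f -> 0 < e ->
  \int[mu]_z (f (x + e *: z) * osc chi th z) =
  \int[mu]_xi (chi (e *: xi) * modosc f x th xi).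
Proof.
move=> tf e0; have fi := testf_integrable tf.
have en0 : e != 0 by rewrite gt_eqF.
have fai : intg (fun z => f (x + e *: z)) := integrable_affine x en0 fi.
pose F (p : V * V) : R := f (x + e *: p.1) * (chi p.2 * cos (dotv p.2 p.1 + th)).
have mF : measurable_fun setT F.
  apply: measurable_funM; last apply: measurable_funM.
  - exact: (measurableT_comp (integrable_measurable fai) measurable_fst).
  - exact: (measurableT_comp (testf_measurable testf_chi) measurable_snd).
  - apply: measurable_cos_comp; apply: measurable_funD => //.
    by apply: measurable_dotv; [exact: measurable_snd|exact: measurable_fst].
have Fab z xi : `|F (z, xi)| <= `|f (x + e *: z)| * `|chi xi|.
  by rewrite normrM ler_wpM2l // normrM ler_piMr // normr_cos_le1.
have := bounded_fubini mF Fab (fun _ => normr_ge0 _) (fun _ => normr_ge0 _)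
  (integrable_normr fai) (integrable_normr chii).
under eq_Rintegral.
  move=> z _; rewrite /F /= RintegralZl //; last exact: osc_integrable.
  over.
move=> ->.
have inner xi : \int[mu]_z F (z, xi) =
    `|e|^-1 ^+ d * (chi xi * modosc f x th (e^-1 *: xi)).
  rewrite /modosc /osc mulrCA -(Rintegral_affine x) //; last exact: osc_integrable.
  rewrite -RintegralZl //; last first.
    exact: (integrable_affine x en0 (osc_integrable _ _ fi)).
  apply: eq_Rintegral => z _; rewrite /F /= mulrCA; congr (_ * (_ * cos _)).
  by rewrite dotvDl dotvZl !dotvZr mulrA divff // mul1r (dotvC z); ring.
rewrite (eq_Rintegral _ (fun xi _ => inner xi)).
pose h xi := chi (e *: xi) * modosc f x th xi.
have hi : intg h.
  apply: (integrable_le _ _ (osc_sum_integrable tf)) => [|xi].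
    apply: measurable_funM; last exact: modosc_measurable.
    exact: (measurableT_comp (testf_measurable testf_chi) (measurable_dilation e)).
  rewrite normrM; apply: le_trans (modosc_le x th xi fi).
  by rewrite ler_piMl // normr_chi_le1.
have e1 : e^-1 != 0 by rewrite invr_eq0.
have hai := integrable_affine 0 e1 hi.
have E xi : h (0 + e^-1 *: xi) = chi xi * modosc f x th (e^-1 *: xi).
  by rewrite add0r /h scalerA (mulfV en0) scale1r.
rewrite (eq_Rintegral _ (fun xi _ => congr1 ( *%R (`|e|^-1 ^+ d)) (esym (E xi)))).
rewrite RintegralZl // Rintegral_affine // normfV invrK mulrA -exprMn.
by rewrite mulVf ?normr_eq0 // expr1n mul1r.
Qed.

(** Let [e] tend to [0] in [inversion_regularized]: on the left [f (x + e z)] tends to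
[f x], on the right [chi (e xi)] tends to [chi 0 = 1]. *)
Lemma fourier_inversion f x th : real_testf f ->
  \int[mu]_xi modosc f x th xi = cos th * inversion_constant * f x.
Proof.
move=> tf; have fi := testf_integrable tf.
pose e (n : nat) : R := n.+1%:R^-1.
have e0 n : 0 < e n by rewrite invr_gt0.
have ecv z y : y + e n *: z @[n --> \oo] --> y.
  rewrite -[X in _ --> X]addr0; apply: cvgD; first exact: cvg_cst.
  rewrite -(scale0r z); apply: cvgZr_tmp; exact: cvg_harmonic.
have [M M0 fM] := testf_bounded tf.
have mfe n : measurable_fun setT (fun z => f (x + e n *: z)).
  apply: (measurableT_comp (testf_measurable tf)); exact: measurable_affine.
have lim1 : \int[mu]_z (f (x + e n *: z) * osc chi th z) @[n --> \oo] -->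
    \int[mu]_z (f x * osc chi th z).
  apply: (@Rintegral_dominated _ _ _ _ _ _ (fun z => M * `|osc chi th z|)) => [n|z|n z|].
  - by apply: measurable_funM => //; exact: integrable_measurable (osc_intg _ testf_chi).
  - apply: cvgM; last exact: cvg_cst.
    apply: (@continuous_cvg _ _ _ _ _ (fun n => x + e n *: z) f x).
      exact: testf_continuous.
    exact: ecv.
  - by rewrite normrM ler_wpM2r.
  - exact: (integrableZl measurableT M (integrable_normr (osc_intg _ testf_chi))).
have lim2 : \int[mu]_xi (chi (e n *: xi) * modosc f x th xi) @[n --> \oo] -->
    \int[mu]_xi (modosc f x th xi).
  apply: (@Rintegral_dominated _ _ _ _ _ _ (fun xi => `|osc f 0 xi| + `|osc f (pi / 2) xi|)) => [n|z|n z|].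
  - apply: measurable_funM; last exact: modosc_measurable.
    exact: (measurableT_comp (testf_measurable testf_chi) (measurable_dilation (e n))).
  - rewrite -[X in _ --> X]mul1r -chi0; apply: cvgM; last exact: cvg_cst.
    apply: (@continuous_cvg _ _ _ _ _ (fun n => e n *: z) chi 0).
      exact: testf_continuous testf_chi _.
    have := ecv z 0; by under eq_fun do rewrite add0r.
  - rewrite normrM; apply: le_trans (modosc_le x th z fi).
    by rewrite ler_piMl // normr_chi_le1.
  - exact: osc_sum_integrable.
have E : (fun n => \int[mu]_z (f (x + e n *: z) * osc chi th z)) =
    (fun n => \int[mu]_xi (chi (e n *: xi) * modosc f x th xi)).
  by apply/funext => n; exact: inversion_regularized.
rewrite E in lim1; rewrite -(cvg_unique (@Rhausdorff R) lim1 lim2).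
have -> : \int[mu]_z (f x * osc chi th z) = \int[mu]_z (f x * cos th * osc chi 0 z).
  by apply: eq_Rintegral => z _; rewrite [in LHS]osc_chi mulrA.
rewrite (RintegralZl _ measurableT (osc_intg 0 testf_chi)) -/inversion_constant.
by rewrite -mulrA mulrC.
Qed.

(** If the constant were zero, the cosine transform [A] of [chi] would satisfy
[\int A xi * cos (x.xi) = 0] for all [x].  Integrating against [chi x] gives
[\int A ^ 2 = 0], whereas [A] is continuous and [A 0 = \int chi > 0]. *)
Lemma inversion_constant_neq0 : inversion_constant != 0.
Proof.
apply/eqP => c0; pose A := osc chi 0.
have iA : intg A := osc_intg 0 testf_chi.
have A0 x : \int[mu]_xi (A xi * cos (dotv x xi)) = 0.
  have := fourier_inversion x 0 testf_chi; rewrite c0 mulr0 mul0r => <-.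
  apply: eq_Rintegral => xi _; rewrite modoscE // osc_chi_pihalf mulr0 addr0.
  by rewrite add0r cosN mulrC.
pose F (p : V * V) : R := chi p.1 * (A p.2 * cos (dotv p.1 p.2)).
have mF : measurable_fun setT F.
  apply: measurable_funM; last apply: measurable_funM.
  - exact: (measurableT_comp (testf_measurable testf_chi) measurable_fst).
  - exact: (measurableT_comp (integrable_measurable iA) measurable_snd).
  - apply: measurable_cos_comp.
    by apply: measurable_dotv; [exact: measurable_fst|exact: measurable_snd].
have Fab x xi : `|F (x, xi)| <= `|chi x| * `|A xi|.
  by rewrite normrM ler_wpM2l // normrM ler_piMr // normr_cos_le1.
have := bounded_fubini mF Fab (fun _ => normr_ge0 _) (fun _ => normr_ge0 _)
  (integrable_normr chii) (integrable_normr iA).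
have -> : \int[mu]_x \int[mu]_xi F (x, xi) = 0.
  rewrite (eq_Rintegral _ (g := fun=> 0)).
    by rewrite Rintegral_cst // mul0r.
  move=> x _; rewrite /F /= RintegralZl ?A0 ?mulr0 //.
  by apply: integrable_mul_cos => //; exact: measurable_dotv.
have -> : \int[mu]_xi \int[mu]_x F (x, xi) = \int[mu]_xi (A xi * A xi).
  apply: eq_Rintegral => xi _; rewrite {2}/A /osc -RintegralZl //; last exact: osc_integrable.
  by apply: eq_Rintegral => x _; rewrite /F /= addr0; ring.
move/eqP; rewrite eq_sym; apply/negP; rewrite gt_eqF //.
have cA : continuous A := osc_continuous testf_chi.
have cAA : continuous (fun xi => A xi * A xi) by move=> x; apply: continuousM; exact: cA.
apply: Rintegral_gt0 => // [x||]; first by rewrite -expr2 sqr_ge0.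
  apply: (@integrable_mul_bounded _ _ _ _ _ _ (\int[mu]_y `|chi y|)) => //.
    exact: integrable_measurable iA.
  by move=> x; exact: osc_le.
have : 0 < A 0; last by move=> h; rewrite mulr_gt0.
rewrite /A /osc (eq_Rintegral _ (g := chi)).
  by apply: Rintegral_gt0 => //; [exact: testf_continuous testf_chi|exact: chi_ge0|rewrite chi0].
move=> y _; rewrite addr0 (_ : dotv y 0 = 0) ?cos0 ?mulr1 //.
by rewrite /dotv big1 // => i _; rewrite mxE mulr0.
Qed.

End fourier_inversion.

(** * The inverse Fourier transform of complex functions *)

Section inverse_fourier.
Context {R : realType} {d : nat}.
Local Notation V := 'rV[R]_d.
Local Notation mu := (@lebesgue_rV R d).
Local Notation intg f := (mu.-integrable setT (EFin \o f)).
Local Notation c := (@inversion_constant R d).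

(** Fubini gives the measurability of the truncations to boxes, which converge
pointwise. *)
Lemma osc_measurable (f : V -> R) th : intg f -> measurable_fun setT (osc f th).
Proof.
move=> fi.
(* The indicator makes the integrand dominated by an integrable product. *)
pose f_ (n : nat) (x : V) : R := \1_(box n%:R) x * osc f th x.
have mf_ n : measurable_fun setT (f_ n).
  pose F (p : V * V) : R := \1_(box n%:R) p.1 * (f p.2 * cos (dotv p.2 p.1 + th)).
  have mF : measurable_fun setT F.
    apply: measurable_funM; last apply: measurable_funM.
    - apply: (measurableT_comp (f := \1_(box n%:R) : V -> R) _ measurable_fst).
      by apply: measurable_indic; exact: box_measurable.
    - exact: (measurableT_comp (integrable_measurable fi) measurable_snd).
    - apply: measurable_cos_comp; apply: measurable_funD => //.
      by apply: measurable_dotv; [exact: measurable_snd|exact: measurable_fst].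
  have Fab x xi : `|F (x, xi)| <= \1_(box n%:R) x * `|f xi|.
    rewrite normrM ger0_norm // ler_wpM2l // normrM ler_piMr //.
    exact: normr_cos_le1.
  have := bounded_fubini_integrable1 mF Fab (fun x => ltac:(by rewrite indicE)) (fun _ => normr_ge0 _)
    (integrable_indic_box n%:R) (integrable_normr fi).
  move=> /integrable_measurable; apply: eq_measurable_fun => x _.
  by rewrite /F /= RintegralZl //; exact: osc_integrable.
apply: (measurable_fun_cvg mf_) => x _.
have [B xB] : exists n : nat, box n%:R x.
  have [B] := @bounded_sub_box R d [set x] (compact_bounded (compact_set1 (x := x))).
  move=> /(_ x erefl) xB; exists (Num.truncn `|B|).+1 => i.
  have := xB i; rewrite !in_itv /= -!ler_norml => /le_trans; apply.
  by rewrite (le_trans (ler_norm B)) // ltW // truncnS_gt.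
apply: cvg_near_cst; exists B => // n /= Bn.
rewrite /f_ indicE mem_set ?mul1r // => i; have := xB i.
rewrite !in_itv /= -!ler_norml => /le_trans; apply.
by rewrite ler_nat.
Qed.

Lemma integrable_mul_osc (f p : V -> R) th : intg f -> intg p ->
  intg (fun x => p x * osc f th x).
Proof.
move=> fi pint; apply: (integrable_mul_bounded (c := \int[mu]_y `|f y|)) => //.
  exact: osc_measurable.
by move=> x; exact: osc_le.
Qed.

(** Fubini and the symmetry of the kernel. *)
Lemma multiplication_formula (f p : V -> R) th : intg f -> intg p ->
  \int[mu]_x (p x * osc f th x) = \int[mu]_x (f x * osc p th x).
Proof.
move=> fi pint.
pose F (z : V * V) : R := p z.1 * (f z.2 * cos (dotv z.2 z.1 + th)).
have mF : measurable_fun setT F.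
  apply: measurable_funM; last apply: measurable_funM.
  - exact: (measurableT_comp (integrable_measurable pint) measurable_fst).
  - exact: (measurableT_comp (integrable_measurable fi) measurable_snd).
  - apply: measurable_cos_comp; apply: measurable_funD => //.
    by apply: measurable_dotv; [exact: measurable_snd|exact: measurable_fst].
have Fab x xi : `|F (x, xi)| <= `|p x| * `|f xi|.
  by rewrite normrM ler_wpM2l // normrM ler_piMr // normr_cos_le1.
transitivity (\int[mu]_x \int[mu]_xi F (x, xi)).
  apply: eq_Rintegral => x _; rewrite -RintegralZl //; exact: osc_integrable.
rewrite (bounded_fubini mF Fab (fun _ => normr_ge0 _) (fun _ => normr_ge0 _)
  (integrable_normr pint) (integrable_normr fi)).
apply: eq_Rintegral => y _; rewrite -RintegralZl //; last exact: osc_integrable.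
by apply: eq_Rintegral => x _; rewrite /F /= dotvC mulrCA.
Qed.

(** The function [c^-1 * \int f y * e^{i y.x}], with [c] the inversion constant.  It
is applied both to test functions and to integrable Fourier transforms. *)
Definition invft (f : V -> R[i]) (x : V) : R[i] :=
  Complex (c^-1 * osc (reF f) 0 x + c^-1 * osc (imF f) (pi / 2) x)
          (c^-1 * osc (imF f) 0 x + - c^-1 * osc (reF f) (pi / 2) x).

Definition complex_testf (f : V -> R[i]) := real_testf (reF f) /\ real_testf (imF f).

Lemma invft_schwartz (f : V -> R[i]) : complex_testf f -> invft f \in schwartz_pred.
Proof.
move=> [t1 t2]; apply: (schwartz_criterion (@osc_pair_decay_stable R d)).
  by exists (reF f), (imF f), c^-1, c^-1, 0, (pi / 2).
by exists (imF f), (reF f), c^-1, (- c^-1), 0, (pi / 2).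
Qed.

Lemma complex_testf_schwartz (f : V -> R[i]) : complex_testf f -> f \in schwartz_pred.
Proof. by move=> [t1 t2]; exact: (schwartz_criterion testf_decay_stable). Qed.

Lemma invft_rsmooth (f : V -> R[i]) : complex_testf f ->
  rsmooth (reF (invft f)) /\ rsmooth (imF (invft f)).
Proof.
move=> [t1 t2]; split; apply: (decay_stable_smooth (@osc_pair_decay_stable R d)).
  by exists (reF f), (imF f), c^-1, c^-1, 0, (pi / 2).
by exists (imF f), (reF f), c^-1, (- c^-1), 0, (pi / 2).
Qed.

Lemma fourier_schwartz (f : V -> R[i]) : complex_testf f -> fourier f \in schwartz_pred.
Proof.
move=> [t1 t2]; have i1 := testf_integrable t1; have i2 := testf_integrable t2.
have iZ a th xi k : intg k -> intg (fun y => a * (k y * cos (dotv y xi + th))).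
  by move=> ki; exact: (integrableZl measurableT a (osc_integrable th xi ki)).
apply: (schwartz_criterion (@osc_pair_decay_stable R d)).
  exists (reF f), (imF f), 1, (-1), 0, (pi / 2); split=> //.
  apply/funext => xi; rewrite /osc -!RintegralZl //; [|exact: osc_integrable..].
  rewrite -RintegralD //; [|exact: iZ..].
  apply: eq_Rintegral => y _; rewrite addr0 cosDpihalf /reF /imF.
  by case: (f y) => u v /=; ring.
exists (imF f), (reF f), 1, 1, 0, (pi / 2); split=> //.
apply/funext => xi; rewrite /osc -!RintegralZl //; [|exact: osc_integrable..].
rewrite -RintegralD //; [|exact: iZ..].
apply: eq_Rintegral => y _; rewrite addr0 cosDpihalf /reF /imF.
by case: (f y) => u v /=; ring.
Qed.

Lemma modosc_integrable (f : V -> R) x th : real_testf f -> intg (modosc f x th).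
Proof.
move=> tf; apply: integrable_le (osc_sum_integrable tf).
  exact: modosc_measurable.
by move=> xi; apply: modosc_le; exact: testf_integrable.
Qed.

(** The real and the imaginary parts expand into the integrands [modosc] with the
phases [0] and [pi / 2], to which [fourier_inversion] applies. *)
Lemma fourier_invft (f : V -> R[i]) x : complex_testf f -> fourier (invft f) x = f x.
Proof.
move=> [t1 t2]; have i1 := testf_integrable t1; have i2 := testf_integrable t2.
have c0 := @inversion_constant_neq0 R d.
have iZ a k th : real_testf k -> intg (fun xi => a * modosc k x th xi).
  by move=> tk; exact: (integrableZl measurableT a (modosc_integrable x th tk)).
have I k a th : real_testf k -> \int[mu]_xi (a * modosc k x th xi) =
    a * (cos th * c * k x).
  by move=> tk; rewrite RintegralZl // ?fourier_inversion //; exact: modosc_integrable.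
have E : f x = Complex (reF f x) (imF f x) by rewrite /reF /imF; case: (f x).
rewrite E /fourier /Cintegral; congr Complex.
  transitivity (\int[mu]_xi (c^-1 * modosc (reF f) x 0 xi +
      c^-1 * modosc (imF f) x (pi / 2) xi)).
    apply: eq_Rintegral => xi _; rewrite !modoscE // {1}/reF /= (dotvC x).
    rewrite add0r cosN sinN cosB sinB cos_pihalf sin_pihalf; ring.
  rewrite RintegralD //; [|exact: iZ..].
  by rewrite !I // cos0 cos_pihalf; field.
transitivity (\int[mu]_xi (c^-1 * modosc (imF f) x 0 xi +
      - c^-1 * modosc (reF f) x (pi / 2) xi)).
  apply: eq_Rintegral => xi _; rewrite !modoscE // {1}/imF /= (dotvC x).
  rewrite add0r cosN sinN cosB sinB cos_pihalf sin_pihalf; ring.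
rewrite RintegralD //; [|exact: iZ..].
by rewrite !I // cos0 cos_pihalf; field.
Qed.

Lemma invft_bound (g : V -> R[i]) x : intg (reF g) -> intg (imF g) ->
  normc (invft g x) <= 2 * `|c^-1| * (\int[mu]_y `|reF g y| + \int[mu]_y `|imF g y|).
Proof.
move=> i1 i2; apply: le_trans (normc_le _) _.
rewrite /invft /= -mulrA mulr_natl mulr2n; apply: lerD; apply: le_trans (ler_normD _ _) _;
  rewrite !normrM ?normrN mulrDr.
  by apply: lerD; rewrite ler_wpM2l // osc_le.
by rewrite addrC; apply: lerD; rewrite ler_wpM2l // osc_le.
Qed.

(** The multiplication formula on each of the products of components. *)
Lemma invft_pairing (f g : V -> R[i]) : complex_testf f -> intg (reF g) -> intg (imF g) ->
  Cintegral setT (fun xi => g xi * invft f xi) =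
  Cintegral setT (fun x => invft g x * f x).
Proof.
move=> [t1 t2] p1 p2; have i1 := testf_integrable t1; have i2 := testf_integrable t2.
have iZ a h k th : intg h -> intg k -> intg (fun x => a * (h x * osc k th x)).
  by move=> hi ki; exact: (integrableZl measurableT a (integrable_mul_osc th ki hi)).
have ML a h k th : intg h -> intg k -> \int[mu]_x (a * (h x * osc k th x)) =
    \int[mu]_x (a * (k x * osc h th x)).
  move=> hi ki; rewrite !RintegralZl //; [|exact: integrable_mul_osc..].
  by rewrite multiplication_formula.
have I4 h1 h2 h3 h4 : intg h1 -> intg h2 -> intg h3 -> intg h4 ->
    \int[mu]_x (h1 x + h2 x + (h3 x + h4 x)) =
    \int[mu]_x h1 x + \int[mu]_x h2 x + (\int[mu]_x h3 x + \int[mu]_x h4 x).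
  move=> j1 j2 j3 j4; rewrite RintegralD //; last 2 first.
  - exact: (integrableD measurableT j1 j2).
  - exact: (integrableD measurableT j3 j4).
  by rewrite !RintegralD.
set p := reF g in p1 *; set q := imF g in p2 *.
set u := reF f in t1 i1 *; set v := imF f in t2 i2 *.
congr Complex.
- transitivity (\int[mu]_x (c^-1 * (p x * osc u 0 x) + c^-1 * (p x * osc v (pi / 2) x) +
     (- c^-1 * (q x * osc v 0 x) + c^-1 * (q x * osc u (pi / 2) x)))).
    apply: eq_Rintegral => x _; rewrite /p /q /u /v /reF /imF /=.
    by case: (g x) => a b /=; ring.
  rewrite I4; [|exact: iZ..].
  rewrite !(ML _ p) // !(ML _ q) // -I4; [|exact: iZ..].
  apply: eq_Rintegral => x _; rewrite /p /q /u /v /reF /imF /=.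
  by case: (f x) => a b /=; ring.
- transitivity (\int[mu]_x (c^-1 * (q x * osc u 0 x) + c^-1 * (q x * osc v (pi / 2) x) +
     (c^-1 * (p x * osc v 0 x) + - c^-1 * (p x * osc u (pi / 2) x)))).
    apply: eq_Rintegral => x _; rewrite /p /q /u /v /reF /imF /=.
    by case: (g x) => a b /=; ring.
  rewrite I4; [|exact: iZ..].
  rewrite !(ML _ p) // !(ML _ q) // -I4; [|exact: iZ..].
  apply: eq_Rintegral => x _; rewrite /p /q /u /v /reF /imF /=.
  by case: (f x) => a b /=; ring.
Qed.

End inverse_fourier.

(** * Gluing two Fourier transforms *)

Section frequency_splitting.
Context {R : realType} {d : nat}.
Local Notation V := 'rV[R]_d.
Local Notation mu := (@lebesgue_rV R d).
Local Notation intg f := (mu.-integrable setT (EFin \o f)).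
Local Notation c := (@inversion_constant R d).
Implicit Types (w : tempered R d) (g : V -> R[i]).

Lemma test_function_complex_testf Omega (psi : schwartz R d) :
  test_function Omega psi -> complex_testf psi.
Proof.
move=> [cK _]; have /asboolP[sm _] := valP psi.
have [B sB] := bounded_sub_box (compact_bounded cK).
have z x : ~ box B x -> psi x = 0.
  move=> xB; apply: contrapT => /eqP px; apply: xB; apply: sB.
  exact: subset_closure.
have sr : rsmooth (reF psi) /\ rsmooth (imF psi).
  split=> s; have [h1 h2 h3] := sm s.
    by rewrite -reF_partials; split=> // i x; case: (h3 i x).
  by rewrite -imF_partials; split=> // i x; case: (h3 i x).
case: sr => sr si.
by split; split=> //; exists B => x /z; rewrite /reF /imF => ->.
Qed.

Definition splice (k : V -> R) g1 g2 : V -> R[i] := fun xi =>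
  Complex (k xi * reF g1 xi + (1 - k xi) * reF g2 xi)
          (k xi * imF g1 xi + (1 - k xi) * imF g2 xi).

(** Write [phi] for the inverse transform of [psi].  As [k * phi] is a test function,
[w] at its Fourier transform equals both [\int g1 * k * phi] and
[\int g2 * k * phi].  Adding the difference, which is zero, to
[w psi = \int g2 * phi] gives the formula. *)
Lemma splice_pairing w g1 g2 (k : V -> R) (psi : schwartz R d) :
  fourier_transform_is w g1 -> fourier_transform_is w g2 -> real_testf k -> complex_testf psi ->
  w psi = Cintegral setT (fun xi => splice k g1 g2 xi * invft psi xi).
Proof.
move=> [_ ig1 F1] [_ ig2 F2] tk tpsi.
pose phi := Schwartz (invft_schwartz tpsi).
pose kphi (xi : V) : R[i] := Complex (reF phi xi * k xi) (imF phi xi * k xi).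
have [s1 s2] := invft_rsmooth tpsi.
have tkphi : complex_testf kphi by split; [exact: (testfM s1 tk)|exact: (testfM s2 tk)].
pose Kphi := Schwartz (complex_testf_schwartz tkphi).
pose psi' := Schwartz (fourier_schwartz tkphi).
have H : w psi = Cintegral setT (fun xi => g2 xi * phi xi).
  by apply: F2 => xi; rewrite [RHS]fourier_invft.
have K1 : w psi' = Cintegral setT (fun xi => g1 xi * Kphi xi) by apply: F1.
have K2 : w psi' = Cintegral setT (fun xi => g2 xi * Kphi xi) by apply: F2.
have [a1 a2] := ig1 Kphi; have [b1 b2] := ig2 Kphi; have [c1 c2] := ig2 phi.
have := K1; rewrite K2 => -[E1 E2]; rewrite H; congr Complex.
- transitivity (\int[mu]_xi (reF (fun xi => g1 xi * Kphi xi) xi -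
      reF (fun xi => g2 xi * Kphi xi) xi + reF (fun xi => g2 xi * phi xi) xi)).
    rewrite RintegralD //; last exact: (integrableB measurableT a1 b1).
    by rewrite RintegralB // E1 subrr add0r.
  apply: eq_Rintegral => xi _; rewrite /splice /= /kphi /reF /imF /=.
  by case: (g1 xi) (g2 xi) => [u1 v1] [u2 v2] /=; ring.
- transitivity (\int[mu]_xi (imF (fun xi => g1 xi * Kphi xi) xi -
      imF (fun xi => g2 xi * Kphi xi) xi + imF (fun xi => g2 xi * phi xi) xi)).
    rewrite RintegralD //; last exact: (integrableB measurableT a2 b2).
    by rewrite RintegralB // E2 subrr add0r.
  apply: eq_Rintegral => xi _; rewrite /splice /= /kphi /reF /imF /=.
  by case: (g1 xi) (g2 xi) => [u1 v1] [u2 v2] /=; ring.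
Qed.

Lemma Cintegral_restrict (Omega : set V) (h : V -> R[i]) :
  (forall x, ~ Omega x -> h x = 0) -> Cintegral setT h = Cintegral Omega h.
Proof.
move=> h0; congr Complex; rewrite [RHS]Rintegral_mkcond; apply: eq_Rintegral => x _;
  rewrite patchE; case: ifPn => // /negP nx; rewrite /reF /imF h0 //;
  by move=> ox; apply: nx; rewrite inE.
Qed.

Lemma invft_measurable g : intg (reF g) -> intg (imF g) ->
  Cmeasurable setT (invft g).
Proof.
move=> i1 i2; split; apply: measurable_funD; apply: measurable_funM => //;
  exact: osc_measurable.
Qed.

Lemma invft_restriction (Omega : set V) w g : bounded_domain Omega ->
  intg (reF g) -> intg (imF g) ->
  (forall psi : schwartz R d, complex_testf psi ->
     w psi = Cintegral setT (fun xi => g xi * invft psi xi)) ->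
  restriction_is Omega w (invft g).
Proof.
move=> [oO _ _ bO] i1 i2 wE; have [m1 m2] := invft_measurable i1 i2.
have bnd x := invft_bound x i1 i2.
set S := 2 * _ * _ in bnd.
split.
- by split; [exact: measurable_funS m1|exact: measurable_funS m2].
- move=> K cK KO; have mK := compact_measurable_rV cK.
  have Kf : (mu K < +oo)%E.
    have [B KB] := bounded_sub_box (compact_bounded cK).
    apply: le_lt_trans (box_finite (d := d) B).
    by apply: le_measure => //; rewrite inE //; exact: box_measurable.
  split; apply: measurable_bounded_integrable => //.
  + exact: measurable_funS m1.
  + exists S; split; first exact: num_real.
    move=> y Sy x _; apply: le_trans (ltW Sy).
    exact: le_trans (normr_Re_le _) (bnd x).
  + exact: measurable_funS m2.
  + exists S; split; first exact: num_real.
    move=> y Sy x _; apply: le_trans (ltW Sy).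
    exact: le_trans (normr_Im_le _) (bnd x).
- move=> psi tpsi; have ct := test_function_complex_testf tpsi; rewrite wE // invft_pairing //.
  apply: Cintegral_restrict => x xO; rewrite (_ : psi x = 0) ?mulr0 //.
  apply: contrapT => /eqP px; apply: xO; apply: tpsi.2.
  exact: subset_closure.
Qed.

Lemma normc_measurable g : Cmeasurable setT g -> measurable_fun setT (fun x => normc (g x)).
Proof.
move=> [m1 m2].
rewrite (_ : (fun x => _) = (fun x => Num.sqrt (reF g x ^+ 2 + imF g x ^+ 2))); last first.
  by apply/funext => x; rewrite /reF /imF; case: (g x).
apply: (measurableT_comp (f := @Num.sqrt R)).
  by apply: continuous_measurable_fun; exact: sqrt_continuous.
by apply: measurable_funD; apply: measurable_funX.
Qed.

Lemma bounded_domain_finite (Omega : set V) : bounded_domain Omega ->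
  measurable Omega /\ (mu Omega < +oo)%E.
Proof.
move=> [oO _ _ bO]; have mO := open_measurable_rV oO; split=> //.
have [B OB] := bounded_sub_box bO.
apply: le_lt_trans (box_finite (d := d) B).
by apply: le_measure => //; rewrite inE //; exact: box_measurable.
Qed.

(** The inverse transform is bounded by the [L^1] norm of [g], and [Omega] has finite
measure. *)
Lemma L2norm_invft_le (Omega : set V) w g : bounded_domain Omega ->
  intg (reF g) -> intg (imF g) ->
  (forall psi : schwartz R d, complex_testf psi ->
     w psi = Cintegral setT (fun xi => g xi * invft psi xi)) ->
  (L2norm Omega w <= (2 * `|c^-1| * (\int[mu]_y `|reF g y| + \int[mu]_y `|imF g y|) *
     Num.sqrt (fine (mu Omega)))%:E)%E.
Proof.
move=> bO i1 i2 wE; have [mO fO] := bounded_domain_finite bO.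
have bnd x := invft_bound x i1 i2.
set S := 2 * _ * _ in bnd *.
have S0 : 0 <= S by exact: le_trans (normc_ge0 _) (bnd 0).
have mn := normc_measurable (invft_measurable i1 i2).
apply: (@le_trans _ _ ((\int[mu]_(x in Omega) (normc (invft g x) ^+ 2)%:E) `^ 2^-1)%E).
  apply: ereal_inf_lbound; exists (invft g) => //.
  exact: invft_restriction.
apply: (@le_trans _ _ (((S ^+ 2 * fine (mu Omega))%:E) `^ 2^-1)%E).
  apply: gt0_ler_poweR => //; rewrite ?in_itv /= ?leey ?andbT.
  - by apply: integral_ge0 => x _; rewrite lee_fin exprn_ge0 // normc_ge0.
  - by rewrite lee_fin mulr_ge0 ?exprn_ge0 // fine_ge0.
  apply: (@le_trans _ _ (\int[mu]_(x in Omega) (S ^+ 2)%:E)%E).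
    apply: ge0_le_integral => //.
    - apply/measurable_EFinP; apply: measurable_funX; exact: measurable_funS mn.
    - move=> x _; rewrite lee_fin; apply: lerXn2r; rewrite ?nnegrE ?normc_ge0 //.
      exact: bnd.
  by rewrite integral_cst // [leRHS]EFinM fineK // ge0_fin_numE.
rewrite poweR_EFin lee_fin powR12_sqrt; last first.
  by rewrite mulr_ge0 ?exprn_ge0 // fine_ge0.
by rewrite sqrtrM ?exprn_ge0 // sqrtr_sqr ger0_norm.
Qed.

End frequency_splitting.

(** * Interpolation between Barron integrals *)

Section barron_interpolation.
Context {R : realType} {d : nat}.
Local Notation V := 'rV[R]_d.
Local Notation mu := (@lebesgue_rV R d).
Local Notation intg f := (mu.-integrable setT (EFin \o f)).
Local Notation c := (@inversion_constant R d).
Implicit Types (w u v : tempered R d) (g : V -> R[i]) (s t : R).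

Lemma bracket_gt0 (x : V) : 0 < 1 + dotv x x.
Proof. exact: lt_le_trans (bracket_ge1 x). Qed.

Lemma barron_weight_measurable s g : Cmeasurable setT g ->
  measurable_fun setT (fun xi => (normc (g xi) * (1 + dotv xi xi) `^ (s / 2))%:E).
Proof.
move=> mg; apply/measurable_EFinP; apply: measurable_funM; first exact: normc_measurable.
apply: (measurableT_comp (measurable_powR (s / 2))); apply: measurable_funD => //.
exact: measurable_dotv.
Qed.

Lemma barron_weight_ge0 s g xi : (0 <= (normc (g xi) * (1 + dotv xi xi) `^ (s / 2))%:E)%E.
Proof. by rewrite lee_fin mulr_ge0 ?normc_ge0 ?powR_ge0. Qed.

Lemma barron_integral_ge0 s g : (0 <= barron_integral s g)%E.
Proof. by apply: integral_ge0 => xi _; exact: barron_weight_ge0. Qed.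

Lemma le_barron_integral s t g : Cmeasurable setT g -> s <= t ->
  (barron_integral s g <= barron_integral t g)%E.
Proof.
move=> mg st; apply: ge0_le_integral => //.
- by move=> xi _; exact: barron_weight_ge0.
- exact: barron_weight_measurable.
- exact: barron_weight_measurable.
move=> xi _; rewrite lee_fin ler_wpM2l ?normc_ge0 // ler_powR ?bracket_ge1 //.
by rewrite ler_pM2r.
Qed.

Lemma barronW s t u : s <= t -> barron t u -> barron s u.
Proof.
move=> st [g [mg ig Fg] bg]; exists g => //.
exact: le_lt_trans (le_barron_integral mg st) bg.
Qed.

Lemma splice_measurable (k : V -> R) g1 g2 : measurable_fun setT k ->
  Cmeasurable setT g1 -> Cmeasurable setT g2 -> Cmeasurable setT (splice k g1 g2).
Proof.
move=> mk [r1 i1] [r2 i2]; split; apply: measurable_funD; apply: measurable_funM => //;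
  exact: measurable_funB.
Qed.

Lemma normc_splice_le (k : V -> R) g1 g2 xi : 0 <= k xi -> k xi <= 1 ->
  normc (splice k g1 g2 xi) <= k xi * normc (g1 xi) + (1 - k xi) * normc (g2 xi).
Proof.
move=> k0 k1; have -> : splice k g1 g2 xi =
    Complex (k xi) 0 * g1 xi + Complex (1 - k xi) 0 * g2 xi.
  by rewrite /splice /reF /imF; case: (g1 xi) (g2 xi) => [a b] [a' b'];
    apply/eqP; rewrite eq_complex /=; apply/andP; split; apply/eqP; ring.
apply: le_trans (le_normcD _ _) _; rewrite !ComplexField.Normc.normcM /=.
by rewrite !expr0n /= !addr0 !sqrtr_sqr !ger0_norm // subr_ge0.
Qed.

(** Pointwise, the low frequencies are charged to [g1] and the high ones to [g2]. *)
Lemma splice_L1 (k : V -> R) g1 g2 s t A B : measurable_fun setT k ->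
  Cmeasurable setT g1 -> Cmeasurable setT g2 ->
  (forall xi, 0 <= k xi) -> (forall xi, k xi <= 1) -> 0 <= A -> 0 <= B ->
  (forall xi, k xi <= A * (1 + dotv xi xi) `^ (s / 2)) ->
  (forall xi, 1 - k xi <= B * (1 + dotv xi xi) `^ (t / 2)) ->
  (\int[mu]_xi (normc (splice k g1 g2 xi))%:E <=
   A%:E * barron_integral s g1 + B%:E * barron_integral t g2)%E.
Proof.
move=> mk mg1 mg2 k0 k1 A0 B0 kA kB.
have mZ C r g : Cmeasurable setT g ->
    measurable_fun setT (fun xi => (C%:E * (normc (g xi) * (1 + dotv xi xi) `^ (r / 2))%:E)%E).
  by move=> mg; apply: emeasurable_funM => //; exact: barron_weight_measurable.
have Z0 C r g xi : 0 <= C -> (0 <= C%:E * (normc (g xi) * (1 + dotv xi xi) `^ (r / 2))%:E)%E.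
  by move=> C0; rewrite mule_ge0 ?lee_fin // -lee_fin barron_weight_ge0.
rewrite /barron_integral -!ge0_integralZl ?lee_fin //; last 4 first.
- exact: barron_weight_measurable.
- by move=> xi _; exact: barron_weight_ge0.
- exact: barron_weight_measurable.
- by move=> xi _; exact: barron_weight_ge0.
rewrite -ge0_integralD //; last 4 first.
- by move=> xi _; exact: Z0.
- exact: mZ.
- by move=> xi _; exact: Z0.
- exact: mZ.
apply: ge0_le_integral => //.
- by move=> xi _; rewrite lee_fin normc_ge0.
- by apply/measurable_EFinP; apply: normc_measurable; exact: splice_measurable.
- by apply: emeasurable_funD; exact: mZ.
move=> xi _; rewrite -!EFinM -EFinD lee_fin.
apply: le_trans (normc_splice_le g1 g2 (k0 xi) (k1 xi)) _.
by apply: lerD; rewrite mulrCA mulrC ler_wpM2l ?normc_ge0.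
Qed.

Lemma L1_components g (r : R) : Cmeasurable setT g ->
  (\int[mu]_xi (normc (g xi))%:E <= r%:E)%E ->
  [/\ intg (reF g), intg (imF g),
    \int[mu]_xi `|reF g xi| <= r & \int[mu]_xi `|imF g xi| <= r].
Proof.
move=> mg gr; have [m1 m2] := mg.
have ni : intg (fun xi => normc (g xi)).
  apply/integrableP; split; first by apply/measurable_EFinP; exact: normc_measurable.
  under eq_integral do rewrite /= (ger0_norm (normc_ge0 _)).
  by apply: le_lt_trans gr _; rewrite ltry.
have nr : \int[mu]_xi normc (g xi) <= r.
  rewrite -lee_fin /Rintegral fineK //.
  exact: integrable_fin_num ni.
have i1 : intg (reF g) by apply: integrable_le ni => // xi; exact: normr_Re_le.
have i2 : intg (imF g) by apply: integrable_le ni => // xi; exact: normr_Im_le.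
split => //; apply: le_trans nr; apply: le_Rintegral => //.
- exact: integrable_normr.
- by move=> xi _; exact: normr_Re_le.
- exact: integrable_normr.
- by move=> xi _; exact: normr_Im_le.
Qed.

(** Selects the frequencies with [1 + |xi|^2] of order at most [tau].  Cutting off
[1 + |xi|^2] rather than [|xi|^2] makes the function vanish for small [tau], so
that the estimates hold for every [tau > 0]. *)
Definition lowpass (tau : R) (xi : V) : R := cutoff ((1 + dotv xi xi) / tau).

Lemma testf_lowpass tau : 0 < tau -> real_testf (lowpass tau).
Proof.
(* On the support |xi|^2 < 2 tau, and 2 tau <= (1 + 2 tau)^2. *)
move=> tau0; apply: (@testf_cutoff _ _ (fun xi => (1 + dotv xi xi) / tau)
    (1 + 2 * tau)) => [||x].
- apply: (@rsmoothM _ _ (cst 1 + (fun x => dotv x x)) (cst tau^-1)); last exact: rsmooth_cst.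
  by apply: rsmoothD; [exact: rsmooth_cst|exact: rsmooth_dotv].
- by rewrite addr_ge0 // mulr_ge0 // ltW.
- rewrite ltr_pdivrMr //; nra.
Qed.

(** Where the cutoff does not vanish, [1 + |xi|^2 < 2 * tau]. *)
Lemma lowpass_le tau s xi : 0 < tau -> 0 < s ->
  lowpass tau xi <= (2 * tau) `^ (s / 2) * (1 + dotv xi xi) `^ (- s / 2).
Proof.
move=> tau0 s0; have w0 := bracket_gt0 xi.
have [h|h] := leP 2 ((1 + dotv xi xi) / tau).
  by rewrite /lowpass cutoff_ge2 // mulr_ge0 // powR_ge0.
apply: le_trans (cutoff_le1 _) _; rewrite mulNr powRN.
rewrite ler_pdivlMr ?powR_gt0 // mul1r; apply: ge0_ler_powR => //.
- by rewrite divr_ge0 // ltW.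
- by rewrite nnegrE ltW.
- by rewrite nnegrE mulr_ge0 // ltW.
- by move: h; rewrite ltr_pdivrMr // => /ltW.
Qed.

Lemma onem_lowpass_le s : 0 < s -> exists2 C, 0 <= C & forall tau xi, 0 < tau ->
  1 - lowpass tau xi <= C * tau^-1 `^ (s / 2) * (1 + dotv xi xi) `^ (s / 2).
Proof.
move=> s0; have [|C C0 CP] := @onem_cutoff_powR R (s / 2); first by rewrite divr_gt0.
exists C => // tau xi tau0; have w0 := bracket_gt0 xi.
apply: le_trans (CP _ _) _; first by rewrite divr_gt0.
by rewrite powRM ?invr_ge0 ?(ltW w0) ?(ltW tau0) // mulrA mulrAC.
Qed.

(** The Barron integral of order [-a] controls the low frequencies, that of order [p]
the high ones. *)
Lemma L2norm_split (Omega : set V) a p : bounded_domain Omega -> 0 < a -> 0 < p ->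
  exists2 C, 0 <= C & forall w g1 g2 A B tau, 0 < tau ->
    fourier_transform_is w g1 -> fourier_transform_is w g2 ->
    (barron_integral (- a) g1 <= A%:E)%E -> (barron_integral p g2 <= B%:E)%E ->
    (L2norm Omega w <= (C * (tau `^ (a / 2) * A + tau^-1 `^ (p / 2) * B))%:E)%E.
Proof.
move=> bO a0 p0; have [D D0 DP] := onem_lowpass_le p0.
(* One constant that dominates those of the low and of the high frequencies. *)
pose E := 2 `^ (a / 2) + D : R.
have E0 : 0 <= E by rewrite addr_ge0 // powR_ge0.
exists (4 * `|c^-1| * Num.sqrt (fine (mu Omega)) * E).
  by rewrite !mulr_ge0.
move=> w g1 g2 A B tau tau0 F1 F2 gA gB.
have [m1 _ _] := F1; have [m2 _ _] := F2.
have A0 : 0 <= A by rewrite -lee_fin (le_trans (barron_integral_ge0 _ _) gA).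
have B0 : 0 <= B by rewrite -lee_fin (le_trans (barron_integral_ge0 _ _) gB).
have tk := testf_lowpass tau0.
pose S := tau `^ (a / 2) * A + tau^-1 `^ (p / 2) * B.
have mS := splice_measurable (testf_measurable tk) m1 m2.
have L1 : (\int[mu]_xi (normc (splice (lowpass tau) g1 g2 xi))%:E <= (E * S)%:E)%E.
  apply: le_trans (splice_L1 (testf_measurable tk) m1 m2
    (fun xi => cutoff_ge0 _) (fun xi => cutoff_le1 _) (powR_ge0 (2 * tau) (a / 2))
    (mulr_ge0 D0 (powR_ge0 tau^-1 (p / 2)))
    (fun xi => lowpass_le xi tau0 a0) (fun xi => DP tau xi tau0)) _.
  apply: le_trans (_ : ((2 * tau) `^ (a / 2) * A + D * tau^-1 `^ (p / 2) * B)%:E <= _)%E.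
    by rewrite EFinD !EFinM; apply: leeD; apply: lee_wpmul2l => //;
      rewrite lee_fin ?mulr_ge0 ?powR_ge0.
  rewrite lee_fin powRM ?(ltW tau0) // /S /E.
  have h1 : 0 <= 2 `^ (a / 2) :> R by exact: powR_ge0.
  have h2 : 0 <= tau `^ (a / 2) * A by rewrite mulr_ge0 ?powR_ge0.
  have h3 : 0 <= tau^-1 `^ (p / 2) * B by rewrite mulr_ge0 ?powR_ge0.
  nra.
have [i1 i2 n1 n2] := L1_components mS L1.
apply: le_trans (L2norm_invft_le bO i1 i2 _) _.
  by move=> psi tpsi; exact: splice_pairing.
rewrite lee_fin -!mulrA (_ : 4 = 2 * 2) -?mulrA; last by ring.
rewrite ler_pM2l // [X in _ <= 2 * X]mulrC mulrA mulrC.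
have q0 : 0 <= `|c^-1| * Num.sqrt (fine (mu Omega)) by rewrite mulr_ge0.
have : \int[mu]_y `|reF (splice (lowpass tau) g1 g2) y| +
  \int[mu]_y `|imF (splice (lowpass tau) g1 g2) y| <= 2 * (E * S) by lra.
rewrite -/S; set X := _ + _; set q := `|_|; set m := Num.sqrt _.
move=> XS; have : 0 <= q * m by []. nra.
Qed.

End barron_interpolation.

(** * Barron norms of differences *)

Section barron_norm_lemmas.
Context {R : realType} {d : nat}.
Local Notation V := 'rV[R]_d.
Local Notation mu := (@lebesgue_rV R d).
Implicit Types (u v w : tempered R d) (g h : V -> R[i]) (s : R).

Lemma tempered_subE u v (psi : schwartz R d) : (u - v) psi = u psi - v psi.
Proof.
have -> : tempered_fun (u - v) = tempered_fun u - tempered_fun v.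
  by [].
by [].
Qed.

Lemma fourier_transform_isB u v g h :
  fourier_transform_is u g -> fourier_transform_is v h ->
  fourier_transform_is (u - v) (fun xi => g xi - h xi).
Proof.
move=> [[mr mi] ig Fg] [[nr ni] ih Fh].
have re (k1 k2 : V -> R[i]) : reF (fun xi => k1 xi - k2 xi) = (fun xi => reF k1 xi - reF k2 xi).
  by apply/funext => xi; rewrite /reF; case: (k1 xi) (k2 xi) => [? ?] [].
have im (k1 k2 : V -> R[i]) : imF (fun xi => k1 xi - k2 xi) = (fun xi => imF k1 xi - imF k2 xi).
  by apply/funext => xi; rewrite /imF; case: (k1 xi) (k2 xi) => [? ?] [].
have E (phi : schwartz R d) : (fun xi => (g xi - h xi) * phi xi) =
    (fun xi => g xi * phi xi - h xi * phi xi).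
  by apply/funext => xi; rewrite mulrBl.
split.
- by split; [rewrite re|rewrite im]; exact: measurable_funB.
- move=> phi; rewrite E; have [a1 a2] := ig phi; have [b1 b2] := ih phi.
  split; [rewrite re|rewrite im].
    exact: (integrableB measurableT a1 b1).
  exact: (integrableB measurableT a2 b2).
- move=> phi psi fp; rewrite tempered_subE (Fg _ _ fp) (Fh _ _ fp) E.
  have [a1 a2] := ig phi; have [b1 b2] := ih phi.
  rewrite /Cintegral re im !RintegralB //.
Qed.

Lemma barron_integralB s g h : Cmeasurable setT g -> Cmeasurable setT h ->
  (barron_integral s (fun xi => g xi - h xi)%R <=
   barron_integral s g + barron_integral s h)%E.
Proof.
move=> mg mh; rewrite /barron_integral -ge0_integralD //; last 4 first.
- by move=> xi _; exact: barron_weight_ge0.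
- exact: barron_weight_measurable.
- by move=> xi _; exact: barron_weight_ge0.
- exact: barron_weight_measurable.
have mgh : Cmeasurable setT (fun xi => g xi - h xi).
  have [[mr mi] [nr ni]] := (mg, mh); split.
    rewrite (_ : reF _ = (fun xi => reF g xi - reF h xi)); first exact: measurable_funB.
    by apply/funext => xi; rewrite /reF; case: (g xi) (h xi) => [? ?] [].
  rewrite (_ : imF _ = (fun xi => imF g xi - imF h xi)); first exact: measurable_funB.
  by apply/funext => xi; rewrite /imF; case: (g xi) (h xi) => [? ?] [].
apply: ge0_le_integral => //.
- by move=> xi _; exact: (barron_weight_ge0 s (fun xi => g xi - h xi)).
- exact: (barron_weight_measurable s mgh).
- by apply: emeasurable_funD; exact: barron_weight_measurable.
move=> xi _; rewrite -EFinD lee_fin -mulrDl ler_wpM2r ?powR_ge0 //.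
by rewrite -(normcN (h xi)); exact: le_normcD.
Qed.

Lemma barron_norm_lt s u (x : R) : (barron_norm s u < x%:E)%E ->
  exists2 g, fourier_transform_is u g & (barron_integral s g <= x%:E)%E.
Proof.
by move=> /ereal_inf_lt[_ [g Fg <-] gx]; exists g => //; exact: ltW.
Qed.

End barron_norm_lemmas.

(** * The stability estimate *)

(** The value [tau = (r / eta) ^ (2 / (p + a))] makes the two terms equal. *)
Lemma interpolation_balance (R : realType) (a p r eta : R) :
  0 < a -> 0 < p -> 0 < r -> 0 < eta ->
  exists2 tau : R, 0 < tau &
    tau `^ (a / 2) * eta = eta `^ (p / (p + a)) * r `^ (a / (p + a)) /\
    tau^-1 `^ (p / 2) * r = eta `^ (p / (p + a)) * r `^ (a / (p + a)).
Proof.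
move=> a0 p0 r0 eta0; have pa : 0 < p + a by rewrite addr_gt0.
have pa0 : p + a != 0 by rewrite gt_eqF.
have q1 : p / (p + a) + a / (p + a) = 1 by field.
have split1 x : 0 < x -> x = x `^ (p / (p + a)) * x `^ (a / (p + a)).
  by move=> x0; rewrite -powRD ?q1 ?powRr1 ?ltW // oner_eq0.
exists ((r / eta) `^ (2 / (p + a))); first by rewrite powR_gt0 // divr_gt0.
have e0 : eta `^ (a / (p + a)) != 0 by rewrite gt_eqF // powR_gt0.
have r1 : r `^ (p / (p + a)) != 0 by rewrite gt_eqF // powR_gt0.
split.
  rewrite -powRrM (_ : 2 / (p + a) * (a / 2) = a / (p + a)); last by field.
  rewrite powRM ?invr_ge0 ?ltW // -(powR_inv1 (ltW eta0)) -powRrM mulN1r powRN.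
  by rewrite {2}(split1 eta) //; field.
rewrite -(powR_inv1 (powR_ge0 _ _)) -!powRrM.
rewrite (_ : 2 / (p + a) * (-1 * (p / 2)) = - (p / (p + a))); last by field.
rewrite powRN powRM ?invr_ge0 ?ltW // -(powR_inv1 (ltW eta0)) -powRrM mulN1r powRN.
rewrite {2}(split1 r) //.
have e1 : eta `^ (p / (p + a)) != 0 by rewrite gt_eqF // powR_gt0.
by field; rewrite e1 r1.
Qed.

Unset Implicit Arguments.

Theorem theorem3p1 (R : realType) (d : nat) (a p r : R)
    (K Omega : set 'rV[R]_d) (Y : completeNormedModType R)
    (DF : set (tempered R d)) (F : tempered R d -> Y)
    (m M : R) (ustar : tempered R d) :
  (0 < d)%N -> 0 < a -> 0 < p -> 0 < r ->
  compact K -> bounded_domain Omega ->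
  (forall u, DF u -> exists s : R, barron s u) ->
  0 < m -> m <= M ->
  (forall u1 u2, (DF `&` barron (- a)) u1 -> (DF `&` barron (- a)) u2 ->
    (m%:E * barron_norm (- a) (u1 - u2)%R <= `|F u1 - F u2|%:E)%E /\
    (`|F u1 - F u2|%:E <= M%:E * barron_norm (- a) (u1 - u2)%R)%E) ->
  barron p ustar ->
  let MR := [set z | [/\ DF z, barron p z, supported_in K z &
                         (barron_norm p (z - ustar)%R <= r%:E)%E]] in
  exists C : R, forall u1 u2, MR u1 -> MR u2 ->
    (L2norm Omega (u1 - u2)%R <=
      (C * `|F u1 - F u2| `^ (p / (p + a)) * r `^ (a / (p + a)))%:E)%E.
Proof.
move=> _ a0 p0 r0 _ bO _ m0 _ link _ MR.
have [C0 C0ge CP] := L2norm_split bO a0 p0.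
pose C := C0 * ((m^-1 + 1) + 4).
have Cge : 0 <= C by rewrite mulr_ge0 // !addr_ge0 // invr_ge0 ltW.
exists C => u1 u2 [D1 B1 _ N1] [D2 B2 _ N2].
set N := `|F u1 - F u2|; set w := u1 - u2.
have ap : - a <= p by lra.
have [lk _] := link u1 u2 (conj D1 (barronW ap B1)) (conj D2 (barronW ap B2)).
have [g2 G2 g2r] : exists2 g2, fourier_transform_is w g2 &
    (barron_integral p g2 <= (4 * r)%:E)%E.
  (* The infimum need not be attained, hence the factor 2. *)
  have lt2r : (r%:E < (2 * r)%:E)%E by rewrite lte_fin; lra.
  have [h1 H1 h1r] := barron_norm_lt (le_lt_trans N1 lt2r).
  have [h2 H2 h2r] := barron_norm_lt (le_lt_trans N2 lt2r).
  exists (fun xi => h1 xi - h2 xi).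
    have -> : w = (u1 - ustar) - (u2 - ustar) by rewrite opprB addrA subrK.
    exact: fourier_transform_isB.
  apply: le_trans (barron_integralB _ _ _) _; [by case: H1|by case: H2|].
  by apply: le_trans (leeD h1r h2r) _; rewrite -EFinD lee_fin; lra.
(* A positive upper bound eta of the misfit leaves room for an almost optimal g1
and covers the case of a zero misfit by letting eta tend to 0. *)
have main eta : 0 < eta -> N <= eta ->
    (L2norm Omega w <= (C * eta `^ (p / (p + a)) * r `^ (a / (p + a)))%:E)%E.
  move=> eta0 Neta.
  have [g1 G1 g1r] : exists2 g1, fourier_transform_is w g1 &
      (barron_integral (- a) g1 <= ((m^-1 + 1) * eta)%:E)%E.
    apply: barron_norm_lt.
    apply: (@le_lt_trans _ _ (m^-1%:E * N%:E)%E); first by rewrite lee_pdivlMl.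
    rewrite -EFinM lte_fin mulrDl mul1r.
    have : m^-1 * N <= m^-1 * eta by rewrite ler_wpM2l // invr_ge0 ltW.
    lra.
  have [tau tau0 [E1 E2]] := interpolation_balance a0 p0 r0 eta0.
  apply: le_trans (CP w g1 g2 _ _ tau tau0 G1 G2 g1r g2r) _.
  rewrite lee_fin /C -!mulrA ler_wpM2l // mulrCA (mulrCA (tau^-1 `^ _)) E1 E2.
  by rewrite -mulrDl.
have [N0|Npos] := leP N 0; last exact: main.
have {}N0 : N = 0 by apply/eqP; rewrite eq_le N0 normr_ge0.
have th0 : 0 < p / (p + a) by rewrite divr_gt0 // addr_gt0.
rewrite N0 powR0 ?gt_eqF // mulr0 mul0r; apply/lee_addgt0Pr => e e0.
pose D := C * r `^ (a / (p + a)).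
have D0 : 0 <= D by rewrite mulr_ge0 // powR_ge0.
(* With this eta the bound D * eta ^ (p / (p + a)) is less than e. *)
pose eta := (e / (D + 1)) `^ (p / (p + a))^-1.
have D1' : 0 < D + 1 by rewrite ltr_wpDl.
have eD : 0 < e / (D + 1) by rewrite divr_gt0.
apply: le_trans (main eta _ _) _; rewrite ?powR_gt0 ?N0 ?powR_ge0 //.
rewrite add0e lee_fin /eta -powRrM mulVf ?gt_eqF // powRr1 ?(ltW eD) //.
rewrite mulrAC -/D mulrA ler_pdivrMr //; nra.
Qed.
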